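(* Let $N$ be a proper normal subgroup of $V_{\mathrm{br}}$. Then $N$ is contained in $P_{\mathrm{br}}$.
   Context: A tree means a finite rooted binary tree (every non-leaf vertex has a left and a right child; the one-vertex tree is allowed); its leaves are numbered $1,\dots,n$ from left to right. A caret is a non-leaf vertex together with its two children. $T\cup\lambda_k$ denotes the tree obtained from $T$ by attaching a caret to its $k$-th leaf. $B_n$ is the braid group on $n$ strands, drawn top to bottom, with product $bc$ meaning $b$ stacked on top of $c$; $PB_n\le B_n$ is the pure braid group. For $b\in B_n$, $\rho_b\in S_n$ sends the bottom position $k$ of a strand to its top position. The cloning map $\kappa_k^n\colon B_n\to B_{n+1}$ replaces the strand with bottom position $k$ by two parallel strands. A braided paired tree diagram is a triple $(T_-,b,T_+)$ with $T_\pm$ trees with the same number $n$ of leaves and $b\in B_n$. An expansion replaces $(T_-,b,T_+)$ by $(T_-\cup\lambda_{\rho_b(k)},\kappa_k^n(b),T_+\cup\lambda_k)$ for some $1\le k\le n$; a reduction is the reverse. Equivalence is generated by expansions and reductions, and we write $(T_-,b,T_+)$ also for its class. $V_{\mathrm{br}}$ is the set of equivalence classes, a group under the multiplication determined by $(T,b,S)(S,c,U)=(T,bc,U)$ (any two elements can be expanded so that this applies). $P_{\mathrm{br}}\le V_{\mathrm{br}}$ is the subgroup of elements of the form $(T,p,T)$ with $p$ a pure braid; it is the kernel of the natural map $V_{\mathrm{br}}\to V$ onto Thompson's group $V$ that replaces the braid $b$ by the permutation $\rho_b$. *)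

(* Defs.v *)
From HB Require Import structures.
From Stdlib Require Import Relation_Operators Operators_Properties Eqdep_dec.
From mathcomp Require Import all_fingroup.
From mathcomp Require Import all_boot generic_quotient.
From mathcomp Require Import boolp classical_sets.
From mathcomp Require Import zify.

Set Implicit Arguments.
Unset Strict Implicit.
Unset Printing Implicit Defensive.

Local Open Scope group_scope.

(* Positions, leaves and generators are numbered from 0: position [k : 'I_n]  *)
(* is the [k.+1]-st one of the usual numbering, and [i : 'I_n.-1] stands for   *)
(* the crossing of the strands at the adjacent positions [i] and [i.+1].       *)

Section CrossingPositions.
Variables (n : nat) (i : 'I_n.-1).

Lemma left_pos_subproof : i < n.
Proof. by case: i => /=; lia. Qed.

Lemma right_pos_subproof : i.+1 < n.
Proof. by case: i => /=; lia. Qed.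

Definition left_pos : 'I_n := Ordinal left_pos_subproof.
Definition right_pos : 'I_n := Ordinal right_pos_subproof.
End CrossingPositions.

(* A word is read from left to right as the braid diagram from top to bottom. *)
(* The letter [(false, i)] is the Artin generator and [(true, i)] its inverse.  *)
Definition letter n : Type := (bool * 'I_n.-1)%type.
Definition word n : Type := seq (letter n).

Inductive artin_eq n : word n -> word n -> Prop :=
| artin_inv e i : artin_eq [:: (e, i); (~~ e, i)] [::]
| artin_far (i j : 'I_n.-1) : i.+1 < j ->
    artin_eq [:: (false, i); (false, j)] [:: (false, j); (false, i)]
| artin_adj (i j : 'I_n.-1) : j = i.+1 :> nat ->
    artin_eq [:: (false, i); (false, j); (false, i)]
             [:: (false, j); (false, i); (false, j)]
| artin_cat u u' v v' :
    artin_eq u u' -> artin_eq v v' -> artin_eq (u ++ v) (u' ++ v')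
| artin_refl w : artin_eq w w
| artin_sym u v : artin_eq u v -> artin_eq v u
| artin_trans u v w : artin_eq u v -> artin_eq v w -> artin_eq u w.

Definition artin_rel n : rel (word n) := fun u v => `[< artin_eq u v >].

Lemma artin_rel_refl n : reflexive (@artin_rel n).
Proof. by move=> w; apply/asboolP; apply: artin_refl. Qed.

Lemma artin_rel_sym n : symmetric (@artin_rel n).
Proof. by move=> u v; apply/asboolP/asboolP; apply: artin_sym. Qed.

Lemma artin_rel_trans n : transitive (@artin_rel n).
Proof.
by move=> v u w /asboolP uv /asboolP vw; apply/asboolP; apply: artin_trans vw.
Qed.

Canonical artin_equiv n := EquivRel (@artin_rel n)
  (@artin_rel_refl n) (@artin_rel_sym n) (@artin_rel_trans n).

Definition braid n : Type := {eq_quot (@artin_equiv n)}%qT.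
HB.instance Definition _ n := Choice.on (braid n).

Definition braid_of n (w : word n) : braid n := (\pi_(braid n) w)%qT.

Lemma braid_ofP n (u v : word n) : braid_of u = braid_of v <-> artin_eq u v.
Proof.
split; first by move=> /eqmodP /asboolP.
by move=> uv; apply/eqmodP/asboolP.
Qed.

Lemma braid_of_repr n (b : braid n) : braid_of (repr b) = b.
Proof. exact: reprK. Qed.

Lemma repr_braid_of n (w : word n) : artin_eq (repr (braid_of w)) w.
Proof. by apply/braid_ofP; rewrite braid_of_repr. Qed.

Lemma braidW n (P : braid n -> Prop) :
  (forall w, P (braid_of w)) -> forall b, P b.
Proof. by move=> Pw b; rewrite -(braid_of_repr b); apply: Pw. Qed.

Definition word_inv n (w : word n) : word n := rev [seq (~~ l.1, l.2) | l <- w].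

Lemma word_inv_cat n (u v : word n) : word_inv (u ++ v) = word_inv v ++ word_inv u.
Proof. by rewrite /word_inv map_cat rev_cat. Qed.

Lemma word_invK n : involutive (@word_inv n).
Proof.
move=> w; rewrite /word_inv map_rev revK -map_comp -[RHS]map_id.
by apply: eq_map => -[e i] /=; rewrite negbK.
Qed.

Lemma word_mulwV n (w : word n) : artin_eq (w ++ word_inv w) [::].
Proof.
elim: w => [|[e i] w IH]; first exact: artin_refl.
rewrite -cat1s word_inv_cat catA -[X in X ++ _]catA.
apply: (artin_trans (v := [:: (e, i)] ++ [::] ++ word_inv [:: (e, i)])).
  rewrite -catA; apply: artin_cat; first exact: artin_refl.
  by apply: artin_cat; [exact: IH | exact: artin_refl].
exact: artin_inv.
Qed.

Lemma word_mulVw n (w : word n) : artin_eq (word_inv w ++ w) [::].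
Proof. by rewrite -{2}(word_invK w); apply: word_mulwV. Qed.

Lemma word_inv_eq n (u v : word n) :
  artin_eq u v -> artin_eq (word_inv u) (word_inv v).
Proof.
move=> uv; apply: (artin_trans (v := word_inv u ++ (v ++ word_inv v))).
  rewrite -{1}[word_inv u]cats0; apply: artin_cat; first exact: artin_refl.
  exact/artin_sym/word_mulwV.
rewrite catA -{2}[word_inv v]cat0s; apply: artin_cat; last exact: artin_refl.
apply: artin_trans (word_mulVw u); apply: artin_cat; first exact: artin_refl.
exact: artin_sym.
Qed.

Definition braid_mul n (b c : braid n) : braid n := braid_of (repr b ++ repr c).
Definition braid_inv n (b : braid n) : braid n := braid_of (word_inv (repr b)).
Definition braid_one n : braid n := braid_of [::].

Lemma braid_mulE n (u v : word n) :
  braid_mul (braid_of u) (braid_of v) = braid_of (u ++ v).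
Proof. by apply/braid_ofP/artin_cat; apply: repr_braid_of. Qed.

Lemma braid_invE n (u : word n) : braid_inv (braid_of u) = braid_of (word_inv u).
Proof. by apply/braid_ofP/word_inv_eq/repr_braid_of. Qed.

Lemma braid_mulA n : associative (@braid_mul n).
Proof.
elim/braidW => u; elim/braidW => v; elim/braidW => w.
by rewrite !braid_mulE catA.
Qed.

Lemma braid_mul1b n : left_id (braid_one n) (@braid_mul n).
Proof. by elim/braidW => u; rewrite braid_mulE. Qed.

Lemma braid_mulb1 n : right_id (braid_one n) (@braid_mul n).
Proof. by elim/braidW => u; rewrite braid_mulE cats0. Qed.

Lemma braid_mulVb n : left_inverse (braid_one n) (@braid_inv n) (@braid_mul n).
Proof.
by elim/braidW => u; rewrite braid_invE braid_mulE; apply/braid_ofP/word_mulVw.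
Qed.

Lemma braid_mulbV n : right_inverse (braid_one n) (@braid_inv n) (@braid_mul n).
Proof.
by elim/braidW => u; rewrite braid_invE braid_mulE; apply/braid_ofP/word_mulwV.
Qed.

HB.instance Definition _ n := isGroup.Build (braid n) (@braid_mulA n)
  (@braid_mul1b n) (@braid_mulb1 n) (@braid_mulVb n) (@braid_mulbV n).

Lemma braid_of_cat n (u v : word n) : braid_of (u ++ v) = braid_of u * braid_of v.
Proof. by rewrite -braid_mulE. Qed.

Lemma braid_of_nil n : braid_of [::] = 1 :> braid n.
Proof. by []. Qed.

Lemma braid_of_inv n (u : word n) : braid_of (word_inv u) = (braid_of u)^-1.
Proof. by rewrite -braid_invE. Qed.

(* [word_perm w] sends bottom positions to top positions.  Products of         *)
(* permutations apply the left factor first, so the bottom part [w] of         *)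
(* [l :: w] comes first.                                                      *)
Fixpoint word_perm n (w : word n) : 'S_n :=
  if w is l :: w' then word_perm w' * tperm (left_pos l.2) (right_pos l.2) else 1.

(* Doubling the strand with bottom position [k] in the crossing [i]: the       *)
(* crossing is shifted when [k] is to its left and unchanged when [k] is to    *)
(* its right; when [k] takes part in it, the strand that is not doubled        *)
(* crosses both parallel strands.                                             *)
Definition clone_gen n (k : 'I_n) (i : 'I_n.-1) : seq 'I_n :=
  if k < i then [:: right_pos i]
  else if k == left_pos i then [:: left_pos i; right_pos i]
  else if k == right_pos i then [:: right_pos i; left_pos i]
  else [:: left_pos i].

Definition clone_letter n (k : 'I_n) (l : letter n) : word n.+1 :=
  [seq (l.1, j) | j <- clone_gen k l.2].

Fixpoint word_clone n (k : 'I_n) (w : word n) : word n.+1 :=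
  if w is l :: w' then clone_letter (word_perm w' k) l ++ word_clone k w'
  else [::].

(* Neither [braid_perm] nor [clone] depends on the chosen representative word: *)
(* see [braid_perm_of] and [clone_of].                                        *)
Definition braid_perm n (b : braid n) : 'S_n := word_perm (repr b).

Definition clone n (k : 'I_n) (b : braid n) : braid n.+1 :=
  braid_of (word_clone k (repr b)).

Definition pure n (b : braid n) : Prop := braid_perm b = 1.

(* The remaining facts about [word_perm] and [word_clone] are proved on words  *)
(* with letters in [bool * nat], to avoid casts between ordinal types.         *)

Definition cross (i p : nat) : nat :=
  if p == i then i.+1 else if p == i.+1 then i else p.

Definition nclone_gen (k i : nat) : seq nat :=
  if k < i then [:: i.+1] else if k == i then [:: i; i.+1]
  else if k == i.+1 then [:: i.+1; i] else [:: i].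

Definition nclone_letter (k : nat) (l : bool * nat) : seq (bool * nat) :=
  [seq (l.1, j) | j <- nclone_gen k l.2].

Fixpoint nperm (w : seq (bool * nat)) (p : nat) : nat :=
  if w is l :: w' then cross l.2 (nperm w' p) else p.

Fixpoint nclone (k : nat) (w : seq (bool * nat)) : seq (bool * nat) :=
  if w is l :: w' then nclone_letter (nperm w' k) l ++ nclone k w' else [::].

Definition nword n (w : word n) : seq (bool * nat) :=
  [seq (l.1, val l.2) | l <- w].

Lemma val_word_perm n (w : word n) p : val (word_perm w p) = nperm (nword w) (val p).
Proof.
elim: w => [|l w IH] /=; first by rewrite perm1.
rewrite permM -IH /cross; case: tpermP => [->|->|].
- by rewrite eqxx.
- by rewrite /= eqxx; case: eqP => //; lia.
- move=> /eqP; rewrite -val_eqE /= => /negbTE-> /eqP.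
  by rewrite -val_eqE /= => /negbTE->.
Qed.

Lemma nword_clone n (k : 'I_n) (w : word n) :
  nword (word_clone k w) = nclone (val k) (nword w).
Proof.
elim: w => //= l w IH; rewrite /nword map_cat [X in _ ++ X]IH; congr cat.
rewrite -val_word_perm /clone_letter /nclone_letter -map_comp /=.
rewrite /clone_gen /nclone_gen -!val_eqE /=.
by do 3 case: ifP => //.
Qed.

Lemma nperm_cat u v p : nperm (u ++ v) p = nperm u (nperm v p).
Proof. by elim: u => //= l u ->. Qed.

Lemma nclone_cat k u v : nclone k (u ++ v) = nclone (nperm v k) u ++ nclone k v.
Proof. by elim: u => //= l u ->; rewrite catA nperm_cat. Qed.

(* Out of range generators are read as the trivial braid. *)
Definition gen N (i : nat) : braid N :=
  if insub i is Some j then braid_of [:: (false, j)] else 1.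

Definition sgen N (l : bool * nat) : braid N :=
  if l.1 then (gen N l.2)^-1 else gen N l.2.

Fixpoint ev N (w : seq (bool * nat)) : braid N :=
  if w is l :: w' then sgen N l * ev N w' else 1.

Lemma ev_cat N u v : ev N (u ++ v) = ev N u * ev N v.
Proof. by elim: u => [|l u IH] /=; rewrite ?mul1g // IH mulgA. Qed.

Lemma ev_nword n (w : word n) : ev n (nword w) = braid_of w.
Proof.
elim: w => [|[e i] w IH] //=; rewrite -cat1s braid_of_cat IH; congr (_ * _).
rewrite /sgen /gen /=; case: insubP => [j _ ji|]; last by rewrite ltn_ord.
have -> : j = i by apply: val_inj.
by case: e => //; rewrite -braid_of_inv.
Qed.

Lemma gen_far N i j : i.+1 < j -> gen N i * gen N j = gen N j * gen N i.
Proof.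
move=> ij; rewrite /gen; case: insubP => [i' _ ii|]; last by rewrite mul1g mulg1.
case: insubP => [j' _ jj|]; last by rewrite mul1g mulg1.
rewrite -!braid_of_cat; apply/braid_ofP/artin_far.
by rewrite ii jj.
Qed.

Lemma gen_adj N i : i.+1 < N.-1 ->
  gen N i * gen N i.+1 * gen N i = gen N i.+1 * gen N i * gen N i.+1.
Proof.
move=> iN; rewrite /gen; case: insubP => [i' _ ii|]; last by lia.
case: insubP => [j' _ jj|]; last by lia.
by rewrite -!braid_of_cat; apply/braid_ofP/artin_adj; rewrite ii jj.
Qed.

Lemma sgen_far N e e' i j : i.+1 < j -> commute (sgen N (e, i)) (sgen N (e', j)).
Proof.
move=> /(gen_far N) c; have {}c : commute (gen N i) (gen N j) by [].
rewrite /sgen /=; case: e => /=; last by case: e' => //=; apply: commuteV.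
by apply/commute_sym/commuteV/commute_sym; case: e' => //=; apply: commuteV.
Qed.

Lemma sgen_inv N e i : sgen N (e, i) * sgen N (~~ e, i) = 1.
Proof. by case: e; rewrite /sgen /= ?mulVg ?mulgV. Qed.

Local Ltac no_if a :=
  lazymatch a with context [if _ then _ else _] => fail | _ => idtac end.

Local Ltac nat_cases :=
  repeat match goal with
  | |- context [if (?a == ?b :> nat) then _ else _] =>
      no_if a; no_if b;
      let H := fresh "H" in case: (@eqP _ a b) => H; try (exfalso; lia)
  | |- context [if (?a < ?b)%N then _ else _] =>
      no_if a; no_if b;
      let H := fresh "H" in case: (ltnP a b) => H; try (exfalso; lia)
  end.

Local Ltac nclone_cases := rewrite /nclone_letter /nclone_gen /cross /=; nat_cases; rewrite /=.

Lemma nperm_artin n (u v : word n) : artin_eq u v ->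
  forall p, nperm (nword u) p = nperm (nword v) p.
Proof.
elim=> {u v} //=.
- by move=> e i p; rewrite /cross; nat_cases; lia.
- by move=> i j ij p; rewrite /cross; nat_cases; lia.
- by move=> i j -> p; rewrite /cross; nat_cases; lia.
- move=> u u' v v' _ IHu _ IHv p.
  by rewrite /nword !map_cat !nperm_cat IHu IHv.
- by move=> u v w _ IHu _ IHv p; rewrite IHu.
Qed.

Lemma sfar N e a b c : a.+1 < b ->
  sgen N (e, a) * (sgen N (e, b) * c) = sgen N (e, b) * (sgen N (e, a) * c).
Proof. by move=> ab; rewrite !mulgA (sgen_far N e e ab). Qed.

Lemma sadj N a c : a.+1 < N.-1 ->
  sgen N (false, a) * (sgen N (false, a.+1) * (sgen N (false, a) * c)) =
  sgen N (false, a.+1) * (sgen N (false, a) * (sgen N (false, a.+1) * c)).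
Proof. by move=> aN; rewrite !mulgA /sgen /= gen_adj. Qed.

Lemma ev_nclone_artin n (u v : word n) : artin_eq u v ->
  forall k : nat, ev n.+1 (nclone k (nword u)) = ev n.+1 (nclone k (nword v)).
Proof.
elim=> {u v} //=.
- move=> e i k; have K j := sgen_inv n.+1 e j.
  have K2 x y : sgen n.+1 (e, x) * (sgen n.+1 (e, y) *
      (sgen n.+1 (~~ e, y) * sgen n.+1 (~~ e, x))) = 1.
    by rewrite (mulgA (sgen _ (e, y))) K mul1g K.
  by nclone_cases; rewrite ?mulg1 ?K ?K2.
{ move=> i j ij k; set s := fun x => sgen n.+1 (false, x).
  have F a b c : a.+1 < b -> s a * (s b * c) = s b * (s a * c) by exact: sfar.
  nclone_cases; rewrite -/(s _) -?/(s _.+1) -?/(s i) -?/(s j) -?/(s i.+1) -?/(s j.+1).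
  all: have h1 : i.+1 < j.+1 by lia.
  all: have h2 : i.+2 < j.+1 by lia.
  all: by rewrite ?(fun c => F i j c ij, fun c => F i j.+1 c h1,
                    fun c => F i.+1 j.+1 c h2). }
{ move=> i j ij k; have jn := ltn_ord j; have {jn} in1 : i.+1 < n.-1 by lia.
  set s := fun x => sgen n.+1 (false, x).
  have F a b c : a.+1 < b -> s a * (s b * c) = s b * (s a * c) by exact: sfar.
  have A a c : a.+1 < n -> s a * (s a.+1 * (s a * c)) = s a.+1 * (s a * (s a.+1 * c)).
    by move=> an; apply: sadj; lia.
  nclone_cases; rewrite -?/(s j) ij -?/(s i.+3) -?/(s i.+2) -?/(s i.+1) -?/(s i) .
  + by rewrite -(F i i.+2) // (A i) 1?(A i.+1) 1?(F i i.+2) //; lia.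
  + by rewrite (A i.+1) ?(F i i.+2 (s _ * (s _ * _))) -1?(F i i.+2 1) 1?(A i) //; lia.
  + by rewrite (F i i.+2) 1?(A i) 1?(A i.+1) 1?(F i i.+2) //; lia.
  + by rewrite (A i.+1) //; lia.
  + by rewrite (A i) //; lia. }
- move=> u u' v v' uu IHu vv IHv k.
  by rewrite /nword !map_cat !nclone_cat !ev_cat (nperm_artin vv) IHu IHv.
- by move=> u v w _ IHu _ IHv k; rewrite IHu.
Qed.

Lemma cross_inj i : injective (cross i).
Proof. by move=> p q; rewrite /cross; nat_cases; lia. Qed.

Lemma nperm_inj w : injective (nperm w).
Proof. by elim: w => // l w IH p q /= /cross_inj/IH. Qed.

Lemma nperm_nclone w k q : q <> k ->
  nperm (nclone k w) (bump k q) = bump (nperm w k) (nperm w q).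
Proof.
move=> qk; elim: w => //= l w IH; rewrite nperm_cat IH.
have : nperm w q <> nperm w k by move=> /nperm_inj.
move: (nperm w q) (nperm w k) => {IH qk} q' k' qk.
by rewrite /bump; case: (leqP k' q') => ?; nclone_cases; rewrite /cross; nat_cases; lia.
Qed.

Lemma ev_nclone_letter N j k l : j < k ->
  ev N (nclone k.+1 (nclone_letter j l)) = ev N (nclone j (nclone_letter k l)).
Proof.
case: l => e i jk.
nclone_cases; nclone_cases; nclone_cases; try done.
by rewrite (@sfar N e i i.+2 _ (ltnSn _)).
Qed.

Lemma ev_nclone_comm N w j k : j <> k ->
  ev N (nclone (bump j k) (nclone j w)) = ev N (nclone (bump k j) (nclone k w)).
Proof.
move=> jk; elim: w => //= l w IH; rewrite !nclone_cat !ev_cat IH; congr (_ * _).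
rewrite !nperm_nclone //; last exact: nesym.
have : nperm w j <> nperm w k by move=> /nperm_inj.
move: (nperm w j) (nperm w k) => {IH jk} j' k' jk; rewrite /bump.
case: (ltngtP j' k') => // jk'; rewrite add0n add1n.
- exact: ev_nclone_letter.
- by rewrite ev_nclone_letter.
Qed.

Lemma braid_perm_of n (w : word n) : braid_perm (braid_of w) = word_perm w.
Proof.
apply/perm.permP => p; apply: val_inj; rewrite !val_word_perm.
exact/nperm_artin/repr_braid_of.
Qed.

Lemma clone_of n (k : 'I_n) (w : word n) :
  clone k (braid_of w) = braid_of (word_clone k w).
Proof.
rewrite /clone -[LHS]ev_nword -[RHS]ev_nword !nword_clone.
exact/ev_nclone_artin/repr_braid_of.
Qed.

Lemma word_perm_cat n (u v : word n) :
  word_perm (u ++ v) = word_perm v * word_perm u.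
Proof. by elim: u => [|l u IH] /=; rewrite ?mulg1 // IH mulgA. Qed.

Lemma word_clone_cat n (k : 'I_n) (u v : word n) :
  word_clone k (u ++ v) = word_clone (word_perm v k) u ++ word_clone k v.
Proof. by elim: u => //= l u ->; rewrite catA word_perm_cat permM. Qed.

Lemma braid_perm1 n : braid_perm (1 : braid n) = 1.
Proof. exact: (braid_perm_of [::]). Qed.

Lemma braid_permM n (b c : braid n) :
  braid_perm (b * c) = braid_perm c * braid_perm b.
Proof.
elim/braidW: b => u; elim/braidW: c => v.
by rewrite -braid_of_cat !braid_perm_of word_perm_cat.
Qed.

Lemma braid_permV n (b : braid n) : braid_perm b^-1 = (braid_perm b)^-1.
Proof.
by apply: (mulIg (braid_perm b)); rewrite -braid_permM mulgV braid_perm1 mulVg.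
Qed.

Lemma clone1 n (k : 'I_n) : clone k 1 = 1.
Proof. exact: (clone_of k [::]). Qed.

Lemma cloneM n (k : 'I_n) (b c : braid n) :
  clone k (b * c) = clone (braid_perm c k) b * clone k c.
Proof.
elim/braidW: b => u; elim/braidW: c => v.
by rewrite -braid_of_cat !clone_of braid_perm_of word_clone_cat braid_of_cat.
Qed.

Lemma cloneV n (k : 'I_n) (b : braid n) :
  clone (braid_perm b k) b^-1 = (clone k b)^-1.
Proof. by apply: (mulIg (clone k b)); rewrite -cloneM !mulVg clone1. Qed.

Lemma braid_perm_clone n (b : braid n) (k q : 'I_n) (q' : 'I_n.+1) :
    q <> k -> val q' = bump k q ->
  val (braid_perm (clone k b) q') = bump (braid_perm b k) (braid_perm b q).
Proof.
move=> qk qq'; elim/braidW: b => w.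
rewrite clone_of !braid_perm_of !val_word_perm qq' nword_clone nperm_nclone //.
by move=> /val_inj.
Qed.

Lemma clone_comm n (b : braid n) (j k : 'I_n) (j' k' : 'I_n.+1) :
    j <> k -> val k' = bump j k -> val j' = bump k j ->
  clone k' (clone j b) = clone j' (clone k b).
Proof.
move=> jk kk' jj'; elim/braidW: b => w.
rewrite !clone_of -!ev_nword !nword_clone kk' jj' ev_nclone_comm //.
by move=> /val_inj.
Qed.

Inductive bintree := Leaf | Caret of bintree & bintree.

Fixpoint nleaves (t : bintree) : nat :=
  if t is Caret l r then (nleaves l + nleaves r)%N else 1%N.

(* Attaches a caret to the leaf [k] when [k < nleaves t]. *)
Fixpoint graft (t : bintree) (k : nat) : bintree :=
  if t is Caret l r then
    if k < nleaves l then Caret (graft l k) r else Caret l (graft r (k - nleaves l))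
  else Caret Leaf Leaf.

Lemma nleaves_graft t k : nleaves (graft t k) = (nleaves t).+1.
Proof.
elim: t k => //= l IHl r IHr k.
by case: ifP => _ /=; rewrite ?IHl ?IHr ?addnS.
Qed.

Definition tree (n : nat) : Type := {t : bintree | nleaves t == n}.

Lemma add_caret_subproof n (T : tree n) (k : 'I_n) : nleaves (graft (val T) k) == n.+1.
Proof. by rewrite nleaves_graft eqSS (valP T). Qed.

Definition add_caret n (T : tree n) (k : 'I_n) : tree n.+1 :=
  Sub (graft (val T) k) (add_caret_subproof T k).

Definition leaf_tree : tree 1%N := Sub Leaf (eqxx 1%N).

(* The braided paired tree diagram (T_-, b, T_+) is [Diagram T_- b T_+]. *)
Record diagram := Diagram {
  diag_size : nat;
  diag_top : tree diag_size;
  diag_braid : braid diag_size;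
  diag_bot : tree diag_size
}.
HB.instance Definition _ := gen_eqMixin diagram.
HB.instance Definition _ := gen_choiceMixin diagram.

Definition expand (x : diagram) (k : 'I_(diag_size x)) : diagram :=
  Diagram (add_caret (diag_top x) (braid_perm (diag_braid x) k))
          (clone k (diag_braid x))
          (add_caret (diag_bot x) k).

Definition expansion (x y : diagram) : Prop := exists k : 'I_(diag_size x), y = expand k.

Definition diagram_eq : diagram -> diagram -> Prop :=
  clos_refl_sym_trans diagram expansion.

Definition diagram_rel : rel diagram := fun x y => `[< diagram_eq x y >].

Lemma diagram_rel_refl : reflexive diagram_rel.
Proof. by move=> x; apply/asboolP; apply: rst_refl. Qed.

Lemma diagram_rel_sym : symmetric diagram_rel.
Proof. by move=> x y; apply/asboolP/asboolP; apply: rst_sym. Qed.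

Lemma diagram_rel_trans : transitive diagram_rel.
Proof.
by move=> y x z /asboolP xy /asboolP yz; apply/asboolP; apply: rst_trans yz.
Qed.

Canonical diagram_equiv := EquivRel diagram_rel
  diagram_rel_refl diagram_rel_sym diagram_rel_trans.

Definition Vbr : Type := {eq_quot diagram_equiv}%qT.
HB.instance Definition _ := Choice.on Vbr.

Definition Vbr_class (x : diagram) : Vbr := (\pi_Vbr x)%qT.

Lemma Vbr_classP x y : Vbr_class x = Vbr_class y <-> diagram_eq x y.
Proof. by split=> [/eqmodP /asboolP | xy] //; apply/eqmodP/asboolP. Qed.

Lemma Vbr_class_repr g : Vbr_class (repr g) = g.
Proof. exact: reprK. Qed.

Definition bdiagram n (T : tree n) (b : braid n) (S : tree n) : Vbr :=
  Vbr_class (Diagram T b S).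

Definition diagram_inv (x : diagram) : diagram :=
  Diagram (diag_bot x) (diag_braid x)^-1 (diag_top x).

Definition Vbr_one : Vbr := bdiagram leaf_tree 1 leaf_tree.

(* The product of the classes of (T, b, S) and (S, c, U) is the class of       *)
(* (T, bc, U); see [Vbr_mulE] below.                                          *)
Definition Vbr_mul (g h : Vbr) : Vbr :=
  xget Vbr_one [set f | exists n (T S U : tree n) (b c : braid n),
    [/\ g = bdiagram T b S, h = bdiagram S c U & f = bdiagram T (b * c) U]].

Definition Vbr_inv (g : Vbr) : Vbr := Vbr_class (diagram_inv (repr g)).

Fixpoint tree_le (t s : bintree) : bool :=
  if t is Caret l r then
    if s is Caret l' r' then tree_le l l' && tree_le r r' else false
  else true.

Fixpoint tree_join (t s : bintree) : bintree :=
  match t, s with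
  | Leaf, _ => s
  | _, Leaf => t
  | Caret l r, Caret l' r' => Caret (tree_join l l') (tree_join r r')
  end.

Lemma nleaves_gt0 t : 0 < nleaves t.
Proof. by elim: t => //= l IHl r IHr; lia. Qed.

Lemma tree_le_refl t : tree_le t t.
Proof. by elim: t => //= l -> r ->. Qed.

Lemma tree_le_joinl t s : tree_le t (tree_join t s).
Proof. by elim: t s => //= l IHl r IHr [|l' r'] /=; rewrite ?tree_le_refl ?IHl ?IHr. Qed.

Lemma tree_le_joinr t s : tree_le s (tree_join t s).
Proof.
elim: t s => [|l IHl r IHr] [|l' r'] //=; rewrite ?tree_le_refl //.
by rewrite IHl IHr.
Qed.

Lemma tree_le_nleaves t s : tree_le t s -> nleaves t <= nleaves s.
Proof.
elim: t s => [|l IHl r IHr] [|l' r'] //=; first by move: (nleaves_gt0 l'); lia.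
by move=> /andP[/IHl ? /IHr ?]; lia.
Qed.

Lemma tree_le_graft t k s : tree_le (graft t k) s -> tree_le t s.
Proof.
elim: t k s => //= l IHl r IHr k s.
by case: ifP => _; case: s => //= l' r' /andP[]; [move/IHl-> | move=> -> /IHr].
Qed.

Lemma tree_le_ext t s : tree_le t s ->
  t = s \/ exists2 k, k < nleaves t & tree_le (graft t k) s.
Proof.
elim: t s => [|l IHl r IHr] [|l' r'] //=; [by left | by right; exists 0 |].
move=> /andP[ll rr]; case: (IHl _ ll) => [el|[k kl kle]].
  case: (IHr _ rr) => [er|[k kl kle]]; first by left; rewrite el er.
  right; exists (k + nleaves l); first by lia.
  have -> : (k + nleaves l < nleaves l) = false by lia.
  by rewrite addnK /= ll.
by right; exists k; [lia | rewrite kl /= kle].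
Qed.

Lemma tree_le_graft2 t j k s : j < k < nleaves t ->
  tree_le (graft t j) s -> tree_le (graft t k) s ->
  tree_le (graft (graft t j) k.+1) s.
Proof.
elim: t j k s => [|l IHl r IHr] j k s /=; first by lia.
move=> /andP[jk kn]; case: ifP => jl; case: ifP => kl; case: s => //= l' r'.
- move=> /andP[jle rr] /andP[kle _]; rewrite nleaves_graft ltnS kl /= rr andbT.
  by apply: IHl => //; apply/andP.
- move=> /andP[jle _] /andP[_ kle]; rewrite nleaves_graft ltnS kl /= jle /=.
  by rewrite subSS.
- lia.
- move=> /andP[ll jle] /andP[_ kle].
  have -> : (k.+1 < nleaves l) = false by lia.
  have -> : k.+1 - nleaves l = (k - nleaves l).+1 by lia.
  by rewrite /= ll; apply: IHr => //; lia.
Qed.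

Lemma graft_comm t j k : j < k < nleaves t ->
  graft (graft t j) k.+1 = graft (graft t k) j.
Proof.
elim: t j k => [|l IHl r IHr] j k /=; first by lia.
move=> /andP[jk kn]; case: ifP => jl; case: ifP => kl /=.
- by rewrite !nleaves_graft ltnS kl (ltn_trans jl) // IHl ?jk.
- by rewrite !nleaves_graft ltnS kl jl subSS.
- lia.
- have -> : (k.+1 < nleaves l) = false by lia.
  have -> : k.+1 - nleaves l = (k - nleaves l).+1 by lia.
  by rewrite jl IHr //; lia.
Qed.

Lemma graft_bump t j k : j <> k -> j < nleaves t -> k < nleaves t ->
  graft (graft t j) (bump j k) = graft (graft t k) (bump k j).
Proof.
move=> jk jn kn; rewrite /bump; case: (ltngtP j k) => // h.
  by rewrite add1n graft_comm // h.
by rewrite add0n add1n -graft_comm // h.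
Qed.

Lemma tree_le_graft_bump t j k s : j <> k -> j < nleaves t -> k < nleaves t ->
  tree_le (graft t j) s -> tree_le (graft t k) s ->
  tree_le (graft (graft t j) (bump j k)) s.
Proof.
move=> jk jn kn; rewrite /bump; case: (ltngtP j k) => // h jle kle.
  by rewrite add1n tree_le_graft2 // h.
by rewrite add0n -graft_comm ?h // tree_le_graft2 // h.
Qed.

Lemma nleaves_tree n (T : tree n) : nleaves (val T) = n.
Proof. by apply/eqP; apply: (valP T). Qed.

Lemma expand_comm (x : diagram) (j k : 'I_(diag_size x))
    (k' : 'I_(diag_size (expand j))) (j' : 'I_(diag_size (expand k))) :
    j <> k -> val k' = bump j k -> val j' = bump k j ->
  expand k' = expand j'.
Proof.
case: x j k k' j' => n T b S /= j k k' j' jk kk jj.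
have bjk : braid_perm b j <> braid_perm b k by move=> /perm_inj.
have nval (i i' : 'I_n) : i <> i' -> val i <> val i' by move=> ne /val_inj.
rewrite /expand /=; congr Diagram.
- apply: val_inj => /=.
  rewrite (braid_perm_clone b (nesym jk) kk) (braid_perm_clone b jk jj).
  by rewrite graft_bump ?nleaves_tree //; apply: nval.
- exact: clone_comm.
- by apply: val_inj; rewrite /= kk jj graft_bump ?nleaves_tree //; apply: nval.
Qed.

Inductive steps : nat -> diagram -> diagram -> Prop :=
| steps0 x : steps 0 x x
| stepsS m x y z : expansion x y -> steps m y z -> steps m.+1 x z.

Local Notation top x := (val (diag_top x)).
Local Notation bot x := (val (diag_bot x)).

Lemma steps_eq m x y : steps m x y -> diagram_eq x y.
Proof.
elim=> {m x y} [x|m x y z xy _ yz]; first exact: rst_refl.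
by apply: rst_trans yz; apply: rst_step.
Qed.

Lemma steps_trans m m' x y z : steps m x y -> steps m' y z -> steps (m + m') x z.
Proof.
elim=> {m x y} // m x y y' xy _ IH yz; rewrite addSn.
exact: stepsS xy (IH yz).
Qed.

Lemma steps_le m x y : steps m x y -> tree_le (bot x) (bot y).
Proof.
elim=> {m x y} [x|m x y z [k ->] _]; first exact: tree_le_refl.
exact: tree_le_graft.
Qed.

Lemma steps_size m x y : steps m x y -> diag_size y = diag_size x + m.
Proof. by elim=> {m x y} [x|m x y z [k ->] _ ->] /=; lia. Qed.

Lemma steps_ext x s : tree_le (bot x) s ->
  exists2 y, steps (nleaves s - diag_size x) x y & bot y = s.
Proof.
have [m] := ubnP (nleaves s - diag_size x); elim: m x => // m IH x sm xs.
case: (tree_le_ext xs) => [<-|[k kn kle]].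
  by exists x; rewrite // nleaves_tree subnn; apply: steps0.
rewrite nleaves_tree in kn; have := tree_le_nleaves kle.
rewrite nleaves_graft nleaves_tree => sn.
have [|//|y xy ys] := IH (@expand x (Ordinal kn)); first by rewrite /=; lia.
exists y => //; have -> : nleaves s - diag_size x = (nleaves s - (diag_size x).+1).+1.
  by lia.
by apply: stepsS xy; exists (Ordinal kn).
Qed.

Lemma bump_lt n (j k : 'I_n) : bump j k < n.+1.
Proof. by have := ltn_ord k; rewrite /bump; lia. Qed.

Lemma expansion_diamond (x y z : diagram) : expansion x y -> expansion x z ->
  y = z \/ exists2 w, expansion y w & expansion z w.
Proof.
move=> [j ->] [k ->]; have [->|/eqP jk] := eqVneq j k; [by left | right].
exists (@expand (expand j) (Ordinal (bump_lt j k))).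
  by exists (Ordinal (bump_lt j k)).
by exists (Ordinal (bump_lt k j)); apply: expand_comm.
Qed.

Lemma expansion_strip m x y z : expansion x y -> steps m x z ->
  exists w m', steps m' y w /\ (z = w \/ expansion z w).
Proof.
move=> xy xz; elim: xz y xy => {m x z} [x|m x x' z xx' x'z IH] y xy.
  by exists y, 0; split; [exact: steps0 | right].
case: (expansion_diamond xy xx') => [->|[w yw x'w]].
  by exists z, m; split; [| left].
have [v [m' [wv zv]]] := IH _ x'w.
by exists v, m'.+1; split => //; apply: stepsS yw wv.
Qed.

Lemma steps_confluent m m' x y z : steps m x y -> steps m' x z ->
  exists w p q, steps p y w /\ steps q z w.
Proof.
move=> xy; elim: xy m' z => {m x y} [x|m x x' y xx' x'y IH] m' z xz.
  by exists z, m', 0; split => //; apply: steps0.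
have [v [q [x'v zv]]] := expansion_strip xx' xz.
have [w [p [q' [yw vw]]]] := IH _ _ x'v.
case: zv => [->|zv]; first by exists w, p, q'.
by exists w, p, q'.+1; split => //; apply: stepsS zv vw.
Qed.

Lemma diagram_eq_join x y : diagram_eq x y ->
  exists w p q, steps p x w /\ steps q y w.
Proof.
elim=> {x y} [x y xy|x|x y _ [w [p [q [? ?]]]]|x y z _ [w [p [q [xw yw]]]]
              _ [w' [p' [q' [yw' zw']]]]].
- by exists y, 1%N, 0; split; [apply: stepsS xy _; apply: steps0 | apply: steps0].
- by exists x, 0, 0; split; apply: steps0.
- by exists w, q, p.
- have [v [r [r' [wv wv']]]] := steps_confluent yw yw'.
  by exists v, (p + r), (q' + r'); split; [apply: steps_trans xw wv |
    apply: steps_trans zw' wv'].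
Qed.

Lemma steps_det m x y z : steps m x y -> steps m x z -> bot y = bot z -> y = z.
Proof.
elim: m x y z => [|m IH] x y z xy xz yz.
  by inversion xy; inversion xz; subst.
inversion xy as [|? ? a ? xa ay]; inversion xz as [|? ? b ? xb bz]; subst.
move: xa xb => [j aE] [k bE]; have [jk|/eqP jk] := eqVneq j k.
  by subst; apply: IH ay bz yz.
have jk' : val j <> val k by move=> /val_inj.
pose c := @expand (expand j) (Ordinal (bump_lt j k)).
have bc : expansion b c.
  rewrite bE; exists (Ordinal (bump_lt k j)); exact: expand_comm.
have ac : expansion a c by rewrite aE; exists (Ordinal (bump_lt j k)).
have cy : tree_le (bot c) (bot y).
  rewrite /c /= tree_le_graft_bump ?nleaves_tree //.
    by move: (steps_le ay); rewrite aE.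
  by move: (steps_le bz); rewrite bE yz.
have := tree_le_nleaves cy; rewrite !nleaves_tree (steps_size xy) /= => cs.
have [e ce ey] := steps_ext cy.
move: ce; rewrite nleaves_tree (steps_size xy) /=.
have -> : diag_size x + m.+1 - (diag_size x).+2 = m.-1 by lia.
move=> ce; have mE : m.-1.+1 = m by lia.
have ae : steps m a e by rewrite -mE; apply: stepsS ac ce.
have be : steps m b e by rewrite -mE; apply: stepsS bc ce.
by rewrite (IH _ _ _ ay ae) ?ey // (IH _ _ _ bz be) ?ey.
Qed.

Lemma expansion_inv x y : expansion x y ->
  expansion (diagram_inv x) (diagram_inv y).
Proof.
move=> [k ->]; exists (braid_perm (diag_braid x) k).
by rewrite /expand /diagram_inv /= cloneV braid_permV permK.
Qed.

Lemma diagram_invK : involutive diagram_inv.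
Proof. by case=> n T b S; rewrite /diagram_inv /= invgK. Qed.

Lemma steps_inv m x y : steps m x y -> steps m (diagram_inv x) (diagram_inv y).
Proof.
elim=> {m x y} [x|m x y z xy _ yz]; first exact: steps0.
by apply: stepsS yz; apply: expansion_inv.
Qed.

Lemma diagram_eq_inv x y : diagram_eq x y ->
  diagram_eq (diagram_inv x) (diagram_inv y).
Proof.
elim=> {x y} [x y xy|x|x y _|x y z _ xy _ yz].
- exact/rst_step/expansion_inv.
- exact: rst_refl.
- exact: rst_sym.
- exact: rst_trans xy yz.
Qed.

Definition composite (x y z : diagram) : Prop :=
  exists n (T S U : tree n) (b c : braid n),
    [/\ x = Diagram T b S, y = Diagram S c U & z = Diagram T (b * c) U].

Lemma Diagram_inj n (T T' : tree n) b b' S S' :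
  Diagram T b S = Diagram T' b' S' -> [/\ T = T', b = b' & S = S'].
Proof.
have inj (P : nat -> Type) (u v : P n) : existT P n u = existT P n v -> u = v.
  exact: (inj_pair2_eq_dec _ PeanoNat.Nat.eq_dec).
by case=> /(inj tree) -> /(inj braid) -> /(inj tree) ->.
Qed.

Lemma composite_fun x y z z' : composite x y z -> composite x y z' -> z = z'.
Proof.
move=> [n [T [S [U [b [c [-> -> ->]]]]]]] [n' [T' [S' [U' [b' [c' [xE yE ->]]]]]]].
have nn : n = n' by have := congr1 diag_size xE.
subst n'; have [-> -> _] := Diagram_inj xE.
by have [_ -> ->] := Diagram_inj yE.
Qed.

Lemma composite_bot x y z : composite x y z -> bot x = top y.
Proof. by move=> [n [T [S [U [b [c [-> -> _]]]]]]]. Qed.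

Lemma compositeP x y : bot x = top y -> exists z, composite x y z.
Proof.
case: x y => n T b S [n' S' c U] /= SS.
have nn : n = n' by rewrite -(nleaves_tree S) [val S]SS nleaves_tree.
subst n'; have {}SS : S = S' by apply: val_inj.
by subst S'; exists (Diagram T (b * c) U), n, T, S, U, b, c.
Qed.

Lemma composite_expand x y z x' : composite x y z -> expansion x x' ->
  exists y' z', [/\ expansion y y', expansion z z' & composite x' y' z'].
Proof.
move=> [n [T [S [U [b [c [-> -> ->]]]]]]] [/= k ->].
pose k0 := (braid_perm c)^-1 k; have kE : braid_perm c k0 = k by rewrite permKV.
exists (@expand (Diagram S c U) k0), (@expand (Diagram T (b * c) U) k0).
split; [by exists k0 | by exists k0 |].
exists n.+1, (add_caret T (braid_perm b k)), (add_caret S k), (add_caret U k0),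
  (clone k b), (clone k0 c).
by rewrite /expand /= braid_permM permM cloneM kE.
Qed.

Lemma composite_inv x y z : composite x y z ->
  composite (diagram_inv y) (diagram_inv x) (diagram_inv z).
Proof.
move=> [n [T [S [U [b [c [-> -> ->]]]]]]]; exists n, U, S, T, c^-1, b^-1.
by rewrite /diagram_inv /= invMg.
Qed.

Lemma composite_steps m x y z x' : composite x y z -> steps m x x' ->
  exists y' z', [/\ steps m y y', steps m z z' & composite x' y' z'].
Proof.
move=> xyz xx'; elim: xx' y z xyz => {m x x'} [x|m x x1 x' xx1 _ IH] y z xyz.
  by exists y, z; split => //; apply: steps0.
have [y1 [z1 [yy1 zz1 xyz1]]] := composite_expand xyz xx1.
have [y' [z' [yy' zz' xyz']]] := IH _ _ xyz1.
by exists y', z'; split => //; [apply: stepsS yy1 yy' | apply: stepsS zz1 zz'].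
Qed.

Lemma composite_steps_r m x y z y' : composite x y z -> steps m y y' ->
  exists x' z', [/\ steps m x x', steps m z z' & composite x' y' z'].
Proof.
move=> /composite_inv xyz /steps_inv yy'.
have [x' [z' [/steps_inv xx' /steps_inv zz' /composite_inv xyz']]] :=
  composite_steps xyz yy'.
rewrite !diagram_invK in xx' zz' xyz'.
by exists (diagram_inv x'), (diagram_inv z').
Qed.

Lemma composite_eq x y z x' y' z' : composite x y z -> composite x' y' z' ->
  diagram_eq x x' -> diagram_eq y y' -> diagram_eq z z'.
Proof.
move=> xyz xyz' /diagram_eq_join[a [p [q [xa xa']]]] yy'.
have [b [c [yb zc abc]]] := composite_steps xyz xa.
have [b' [c' [yb' zc' abc']]] := composite_steps xyz' xa'.
have /diagram_eq_join[d [r [r' [bd bd']]]] : diagram_eq b b'.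
  apply: (rst_trans _ _ _ y); first exact/rst_sym/steps_eq/yb.
  exact: rst_trans yy' (steps_eq yb').
have [e [f [ae cf edf]]] := composite_steps_r abc bd.
have [e' [f' [ae' cf' edf']]] := composite_steps_r abc' bd'.
have rr : r' = r.
  have := composite_bot abc; have := composite_bot abc'.
  move=> /(congr1 nleaves) + /(congr1 nleaves).
  rewrite !nleaves_tree; have := steps_size bd; have := steps_size bd'.
  by lia.
subst r'; have ee : e = e'.
  by apply: (steps_det ae ae'); rewrite (composite_bot edf) (composite_bot edf').
subst e'; rewrite (composite_fun edf' edf) in cf' => {edf edf'}.
apply: rst_trans (steps_eq zc) _; apply: rst_trans (steps_eq cf) _.
apply: rst_sym; exact: rst_trans (steps_eq zc') (steps_eq cf').
Qed.

Lemma Vbr_mul_class x y z : composite x y z ->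
  Vbr_mul (Vbr_class x) (Vbr_class y) = Vbr_class z.
Proof.
move=> xyz; rewrite /Vbr_mul; case: xgetP => [f _|/(_ (Vbr_class z)) []].
  move=> [n [T [S [U [b [c [/Vbr_classP xE /Vbr_classP yE ->]]]]]]].
  apply/Vbr_classP/rst_sym; apply: composite_eq xyz _ xE yE.
  by exists n, T, S, U, b, c.
move: xyz => [n [T [S [U [b [c [-> -> ->]]]]]]].
by exists n, T, S, U, b, c.
Qed.

Lemma Vbr_mulE n (T S U : tree n) (b c : braid n) :
  Vbr_mul (bdiagram T b S) (bdiagram S c U) = bdiagram T (b * c) U.
Proof. by apply: Vbr_mul_class; exists n, T, S, U, b, c. Qed.

Lemma Vbr_invE n (T S : tree n) (b : braid n) :
  Vbr_inv (bdiagram T b S) = bdiagram S b^-1 T.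
Proof.
have /Vbr_classP/diagram_eq_inv/Vbr_classP := Vbr_class_repr (bdiagram T b S).
exact.
Qed.

Lemma Vbr_classW (P : Vbr -> Prop) :
  (forall n (T S : tree n) b, P (bdiagram T b S)) -> forall g, P g.
Proof. by move=> Pd g; rewrite -(Vbr_class_repr g); case: (repr g) => *; apply: Pd. Qed.

Lemma steps_join x y : exists x' y', [/\ diagram_eq x x', diagram_eq y y' &
  bot x' = top y'].
Proof.
pose s := tree_join (bot x) (top y).
have [x' /steps_eq xx' x's] := @steps_ext x s (tree_le_joinl _ _).
have [y' /steps_inv/steps_eq yy' y's] := @steps_ext (diagram_inv y) s (tree_le_joinr _ _).
by exists x', (diagram_inv y'); rewrite diagram_invK in yy'; split; rewrite // x's.
Qed.

(* Any two elements can be expanded so that the multiplication rule applies. *)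
Lemma Vbr_pairW (P : Vbr -> Vbr -> Prop) :
  (forall n (T S U : tree n) b c, P (bdiagram T b S) (bdiagram S c U)) ->
  forall g h, P g h.
Proof.
move=> Pd g h; rewrite -(Vbr_class_repr g) -(Vbr_class_repr h).
have [x' [y' [/Vbr_classP-> /Vbr_classP-> /compositeP[z]]]] :=
  steps_join (repr g) (repr h).
by move=> [n [T [S [U [b [c [-> -> _]]]]]]]; apply: Pd.
Qed.

Lemma Vbr_tripleW (P : Vbr -> Vbr -> Vbr -> Prop) :
  (forall n (T S U W : tree n) b c d,
     P (bdiagram T b S) (bdiagram S c U) (bdiagram U d W)) ->
  forall f g h, P f g h.
Proof.
move=> Pd; apply: Vbr_pairW => n T S U b c h.
rewrite -(Vbr_class_repr h).
pose x := Diagram T b S; pose y := Diagram S c U; pose s := tree_join (val U) (top (repr h)).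
have xy : composite x y (Diagram T (b * c) U) by exists n, T, S, U, b, c.
have [y' yy' y's] := @steps_ext y s (tree_le_joinl _ _).
have [w /steps_inv/steps_eq hw ws] :=
  @steps_ext (diagram_inv (repr h)) s (tree_le_joinr _ _).
rewrite diagram_invK in hw; move/Vbr_classP: hw => ->.
have [x' [z' [/steps_eq/Vbr_classP xx' _ xy']]] := composite_steps_r xy yy'.
move: yy' => /steps_eq/Vbr_classP yy'; rewrite /bdiagram -/x -/y xx' yy'.
move: xy' => [m [T' [S' [U' [b' [c' [xE yE _]]]]]]]; rewrite xE yE /=.
rewrite yE /= in y's; have /compositeP[v] : bot (Diagram S' c' U') = top (diagram_inv w).
  by rewrite /= y's ws.
move=> [m2 [S2 [U2 [W2 [c2 [d2 [e1 -> _]]]]]]].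
have mm : m = m2 by have := congr1 diag_size e1.
subst m2; have [_ _ <-] := Diagram_inj e1; exact: Pd.
Qed.

Lemma steps_id m n (T : tree n) y : steps m (Diagram T 1 T) y ->
  exists p (S : tree p), y = Diagram S 1 S.
Proof.
move xE : (Diagram T 1 T) => x xy.
elim: xy n T xE => {m x y} [x|m x y z [k yE] _ IH] n T xE; first by exists n, T.
subst x; apply: (IH _ (add_caret T k)); rewrite yE /expand /=.
by rewrite braid_perm1 perm1 clone1.
Qed.

Lemma bdiagram1 n (T : tree n) : bdiagram T 1 T = Vbr_one.
Proof.
have [y xy yT] := @steps_ext (Diagram leaf_tree 1 leaf_tree) (val T) isT.
have [p [S yE]] := steps_id xy; subst y; rewrite /= in yT.
have pn : p = n by rewrite -(nleaves_tree S) [val S]yT nleaves_tree.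
subst p; have ST : S = T by apply: val_inj.
by subst S; apply/Vbr_classP/rst_sym/steps_eq/xy.
Qed.

Lemma Vbr_mulA : associative Vbr_mul.
Proof.
by apply: Vbr_tripleW => n T S U W b c d; rewrite !Vbr_mulE mulgA.
Qed.

Lemma Vbr_mul1g : left_id Vbr_one Vbr_mul.
Proof. by elim/Vbr_classW => n T S b; rewrite -(bdiagram1 T) Vbr_mulE mul1g. Qed.

Lemma Vbr_mulg1 : right_id Vbr_one Vbr_mul.
Proof. by elim/Vbr_classW => n T S b; rewrite -(bdiagram1 S) Vbr_mulE mulg1. Qed.

Lemma Vbr_mulVg : left_inverse Vbr_one Vbr_inv Vbr_mul.
Proof.
by elim/Vbr_classW => n T S b; rewrite Vbr_invE Vbr_mulE mulVg bdiagram1.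
Qed.

Lemma Vbr_mulgV : right_inverse Vbr_one Vbr_inv Vbr_mul.
Proof.
by elim/Vbr_classW => n T S b; rewrite Vbr_invE Vbr_mulE mulgV bdiagram1.
Qed.

HB.instance Definition _ :=
  isGroup.Build Vbr Vbr_mulA Vbr_mul1g Vbr_mulg1 Vbr_mulVg Vbr_mulgV.

Lemma bdiagramM n (T S U : tree n) (b c : braid n) :
  bdiagram T b S * bdiagram S c U = bdiagram T (b * c) U.
Proof. exact: Vbr_mulE. Qed.

Lemma bdiagramV n (T S : tree n) (b : braid n) :
  (bdiagram T b S)^-1 = bdiagram S b^-1 T.
Proof. exact: Vbr_invE. Qed.

Definition Pbr : set Vbr :=
  [set g | exists n (T : tree n) (p : braid n), pure p /\ g = bdiagram T p T].

Definition normal_subgroup (G : groupType) (N : set G) : Prop :=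
  [/\ N 1,
      forall x y : G, N x -> N y -> N (x * y),
      forall x : G, N x -> N x^-1 &
      forall x g : G, N x -> N (x ^ g)].

(* Main.v *)
Require Import Defs.
From mathcomp Require Import all_fingroup.
From mathcomp Require Import all_boot.
From mathcomp Require Import boolp classical_sets.
From mathcomp Require Import zify.
Local Open Scope classical_set_scope.
Local Open Scope group_scope.
Set Implicit Arguments.
Unset Strict Implicit.
Unset Printing Implicit Defensive.

(** For a leaf address [a] (a word of left and right turns) the group contains
    a copy [cone a] of itself that acts inside the [a]-th cone of the binary
    tree, and copies in disjoint cones commute.  The theorem is the usual
    normal-subgroup argument for Thompson-like groups, run through these copies.

    Let [N] be normal and let [g] in [N] lie outside [Pbr].  Then [g] moves some
    leaf [u] of its bottom tree to a different leaf [v] of its top tree, and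
    after an expansion the cones [u] and [v] are disjoint
    ([not_Pbr_disjoint]).  Let [rotation] be the caret rotation on three leaves, an
    element of Thompson's group F.  Doubling a strand twice gives the same braid whichever
    half is doubled second ([nclone_parallel]), so [g] conjugates
    [cone u rotation] to [cone v rotation] ([leaf_rotation_slide]); their
    quotient [y] is thus in [N].  This replaces [g] by the braid-free element
    [y], which conjugates the copy of the group at [v01] to the disjoint copy at
    [v10].  The familiar double commutator trick then puts [cone v10 [~ h, h']]
    in [N] for all [h] and [h'] ([normal_contains_cone]).

    It remains to see that the group is perfect, and that its copy in a proper
    cone normally generates it.  Both rest on the crossings, the elements
    (T, sigma_i, T), with at least three leaves.
    - All crossings are conjugate ([crossings_conjugate]).
    - A normal subgroup [K] that contains them is everything: it contains all
      (T, b, T), and expanding (T, sigma_i, T) at leaf [i] shows that it contains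
      every element that moves a caret of the trees to the next leaf
      ([normal_crossings_full]).
    - Let [K] contain all commutators and let [a] be a crossing.  Replacing both
      strands of [a] by two, or by three, parallel strands writes [a] as a
      product of 4, or 9, crossings.  Modulo [K] all crossings agree with [a],
      hence a = a^4 = a^9 and [a] is in [K] ([normal_comb3_crossing]).
    So the group is perfect, and [N] contains its whole copy in the cone [v10];
    that copy contains a crossing ([cone_crossing]), and therefore [N] is
    everything. *)

(** * Diagrams as trees and words with unbounded letters *)

Definition valid n (w : seq (bool * nat)) := all (fun l => l.2.+1 < n) w.

Definition self_tree (t : bintree) : tree (nleaves t) := Sub t (eqxx _).

(** Letters in [bool * nat] and trees without a size index keep all computations
    free of casts between [tree n] and [tree m].  The default value of [insubd]
    is met only when the two trees have different numbers of leaves. *)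
Definition ndiagram (t : bintree) (w : seq (bool * nat)) (s : bintree) : diagram :=
  Diagram (self_tree t) (ev (nleaves t) w) (insubd (self_tree t) s).

Definition vbr t w s : Vbr := Vbr_class (ndiagram t w s).

Lemma Diagram_nword n (T S : tree n) (w : word n) :
  Diagram T (braid_of w) S = ndiagram (val T) (nword w) (val S).
Proof.
case: T S => t tn S; have tE := eqP tn; subst n.
rewrite /ndiagram /= ev_nword; congr Diagram; first exact: val_inj.
by apply: val_inj; rewrite val_insubd (valP S).
Qed.

Lemma valid_nword n w : valid n w -> exists w0 : word n, w = nword w0.
Proof.
elim: w => [|[e i] w IH] /=; first by exists [::].
case/andP=> /= ni /IH[w0 ->].
have ni' : i < n.-1 by lia.
by exists ((e, Ordinal ni') :: w0).
Qed.

Lemma nword_valid n (w : word n) : valid n (nword w).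
Proof.
by rewrite /valid all_map; apply/allP => -[e i] _ /=; have := ltn_ord i; lia.
Qed.

Lemma ndiagramP t w s : nleaves s = nleaves t -> valid (nleaves t) w ->
  exists (T S : tree (nleaves t)) (w0 : word (nleaves t)),
   [/\ val T = t, val S = s, w = nword w0 & ndiagram t w s = Diagram T (braid_of w0) S].
Proof.
move=> st /valid_nword[w0 ->]; have sE : nleaves s == nleaves t by apply/eqP.
exists (self_tree t), (Sub s sE : tree _), w0; split => //.
by rewrite Diagram_nword.
Qed.

Lemma ndiagram_expansion t w s y : nleaves s = nleaves t -> valid (nleaves t) w ->
  expansion (ndiagram t w s) y <-> exists2 k, k < nleaves t &
    y = ndiagram (graft t (nperm w k)) (nclone k w) (graft s k).
Proof.
move=> st /(ndiagramP st)[T [S [w0 [Tt Ss -> ->]]]].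
have expandE (k : 'I_(nleaves t)) : @expand (Diagram T (braid_of w0) S) k =
    ndiagram (graft t (nperm (nword w0) k)) (nclone k (nword w0)) (graft s k).
  rewrite /expand /= clone_of Diagram_nword /= braid_perm_of val_word_perm.
  by rewrite nword_clone Tt Ss.
split=> [[k ->]|[k kt ->]]; first by exists k; rewrite ?expandE.
by exists (Ordinal kt); rewrite expandE.
Qed.

Lemma vbr_expand t w s k : nleaves s = nleaves t -> valid (nleaves t) w ->
    k < nleaves t ->
  vbr t w s = vbr (graft t (nperm w k)) (nclone k w) (graft s k).
Proof.
move=> st wt kt; apply/Vbr_classP/Relation_Operators.rst_step.
by apply/ndiagram_expansion => //; exists k.
Qed.

(** Bridges the two ways in which the size of the middle tree of a product is
    presented: as [nleaves s] and as the equal number [nleaves t]. *)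
Lemma ndiagramE n (T : tree n) w u :
  ndiagram (val T) w u = Diagram T (ev n w) (insubd T u).
Proof.
case: T => t tn; have tE := eqP tn; subst n.
have sE : self_tree t = Sub t tn by apply: val_inj.
by rewrite /ndiagram /= sE.
Qed.

Lemma vbrM t w s w' u : nleaves s = nleaves t -> nleaves u = nleaves t ->
  vbr t w s * vbr s w' u = vbr t (w ++ w') u.
Proof.
move=> st ut; apply: Vbr_mul_class.
exists (nleaves t), (self_tree t), (insubd (self_tree t) s), (insubd (self_tree t) u),
  (ev (nleaves t) w), (ev (nleaves t) w').
split => //; last by rewrite /ndiagram ev_cat.
have sE : val (insubd (self_tree t) s) = s by rewrite val_insubd st eqxx.
rewrite -{1}sE ndiagramE; congr Diagram; apply: val_inj.
by rewrite !val_insubd ut eqxx.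
Qed.

Lemma vbr_nil t : vbr t [::] t = 1.
Proof.
rewrite /vbr /ndiagram /=; have -> : insubd (self_tree t) t = self_tree t.
  by apply: val_inj; rewrite val_insubd /= eqxx.
exact: bdiagram1.
Qed.

Lemma vbr_ev t w w' s : ev (nleaves t) w = ev (nleaves t) w' -> vbr t w s = vbr t w' s.
Proof. by rewrite /vbr /ndiagram => ->. Qed.

Lemma vbrP g : exists t w s,
  [/\ nleaves s = nleaves t, valid (nleaves t) w & g = vbr t w s].
Proof.
elim/Vbr_classW: g => n T S b; exists (val T), (nword (repr b)), (val S).
rewrite !nleaves_tree; split=> //; first exact: nword_valid.
by rewrite /vbr -Diagram_nword braid_of_repr.
Qed.

(** * Diagrams side by side *)
Definition shift k (w : seq (bool * nat)) := [seq (l.1, k + l.2)%N | l <- w].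

Lemma ev_shift_artin n N k (u v : word n) : k + n <= N -> artin_eq u v ->
  ev N (shift k (nword u)) = ev N (shift k (nword v)).
Proof.
move=> knN; elim=> {u v} //=.
- by move=> e i; rewrite mulg1 sgen_inv.
- by move=> i j ij; rewrite !mulg1 /sgen /= gen_far //; lia.
- move=> i j ij; rewrite ij !mulg1 addnS /sgen /= !mulgA gen_adj //.
  by have := ltn_ord j; lia.
- move=> u u' v v' _ IHu _ IHv.
  by rewrite /shift /nword !map_cat !ev_cat IHu IHv.
- by move=> u v w _ IHu _ IHv; rewrite IHu.
Qed.

Lemma repr_ev n w : valid n w -> exists w0 : word n,
  w = nword w0 /\ artin_eq (repr (ev n w)) w0.
Proof.
move=> /valid_nword[w0 ->]; exists w0; split => //.
by rewrite ev_nword; apply: repr_braid_of.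
Qed.

Lemma nperm_valid_ge n w k : valid n w -> n <= k -> nperm w k = k.
Proof.
move=> + nk; elim: w => //= l w IH /andP[ln /IH->].
by rewrite /cross; do 2 (case: eqP => ?; first lia).
Qed.

Lemma nperm_lt n w k : valid n w -> k < n -> nperm w k < n.
Proof.
move=> + kn; elim: w => //= l w IH /andP[ln /IH].
by rewrite /cross; do 2 (case: eqP => ?; first lia).
Qed.

Lemma nperm_shift_lt n w k : k < n -> nperm (shift n w) k = k.
Proof.
move=> kn; elim: w => //= l w ->.
by rewrite /cross; do 2 (case: eqP => ?; first lia).
Qed.

Lemma nperm_shift n w k : nperm (shift n w) (n + k) = n + nperm w k.
Proof.
elim: w => //= l w ->; rewrite /cross.
do 4 (case: eqP => ?; try lia).
Qed.

Lemma nclone_valid_ge n w k : valid n w -> n <= k -> nclone k w = w.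
Proof.
move=> + nk; elim: w => //= -[e i] w IH /andP[/= ln wn].
rewrite (IH wn) (nperm_valid_ge wn nk) /nclone_letter /nclone_gen /=.
case: ltnP => ?; first lia.
by do 2 (case: eqP => ?; first lia).
Qed.

Lemma nclone_shift_lt n w k : k < n -> nclone k (shift n w) = shift n.+1 w.
Proof.
move=> kn; elim: w => //= -[e i] w ->.
rewrite (nperm_shift_lt _ kn) /nclone_letter /nclone_gen /=.
case: ltnP => ?; last lia.
by rewrite addSn.
Qed.

Lemma nclone_shift n w k : nclone (n + k) (shift n w) = shift n (nclone k w).
Proof.
elim: w => //= -[e i] w ->; rewrite nperm_shift /shift map_cat; congr cat.
rewrite /nclone_letter /nclone_gen -!map_comp /=.
rewrite ltn_add2l -addnS !eqn_add2l.
by case: ifP => _; [|case: ifP => _; [|case: ifP => _]]; rewrite //= ?addnS.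
Qed.

Lemma valid_shift n m w : valid m w -> valid (n + m) (shift n w).
Proof.
by move=> wm; rewrite /valid all_map; apply: sub_all wm => -[e i] /=; lia.
Qed.

Lemma valid_leq n m w : n <= m -> valid n w -> valid m w.
Proof. by move=> nm; apply: sub_all => l; lia. Qed.

Lemma valid_pair n m w w' : valid n w -> valid m w' ->
  valid (n + m) (w ++ shift n w').
Proof.
move=> wn wm; rewrite /valid all_cat; apply/andP; split.
  by apply: valid_leq wn; lia.
exact: valid_shift.
Qed.

Lemma nclone_valid n w k : valid n w -> valid n.+1 (nclone k w).
Proof.
elim: w => //= -[e i] w IH /andP[/= iw wn]; rewrite /valid all_cat; apply/andP; split; last exact: IH.
rewrite /nclone_letter /nclone_gen all_map.
by case: ifP => _; [|case: ifP => _; [|case: ifP => _]] => /=; lia.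
Qed.

(** Sets the two diagrams next to each other under a common root. *)
Definition dpair (x y : diagram) : diagram :=
  ndiagram (Caret (val (diag_top x)) (val (diag_top y)))
    (nword (repr (diag_braid x)) ++ shift (diag_size x) (nword (repr (diag_braid y))))
    (Caret (val (diag_bot x)) (val (diag_bot y))).

Lemma ev_artin n N (u v : word n) : n <= N -> artin_eq u v ->
  ev N (nword u) = ev N (nword v).
Proof.
by move=> nN /(ev_shift_artin (k := 0) nN); rewrite /shift !map_id_in // => -[].
Qed.

Lemma dpairE t w s t' w' s' : nleaves s = nleaves t -> nleaves s' = nleaves t' ->
    valid (nleaves t) w -> valid (nleaves t') w' ->
  dpair (ndiagram t w s) (ndiagram t' w' s') =
  ndiagram (Caret t t') (w ++ shift (nleaves t) w') (Caret s s').
Proof.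
move=> st st' /repr_ev[w0 [-> eqw]] /repr_ev[w0' [-> eqw']].
rewrite /dpair /= !val_insubd /= st st' !eqxx /ndiagram; congr Diagram.
rewrite /= !ev_cat (ev_artin _ eqw) ?(ev_shift_artin _ eqw') //.
exact: leq_addr.
Qed.

Lemma diagramW (P : diagram -> Prop) :
  (forall t w s, nleaves s = nleaves t -> valid (nleaves t) w -> P (ndiagram t w s)) ->
  forall x, P x.
Proof.
move=> Pn [n T b S]; rewrite -(braid_of_repr b) Diagram_nword.
by apply: Pn; rewrite !nleaves_tree // nword_valid.
Qed.

Lemma dpair_expandl x x' y : expansion x x' -> expansion (dpair x y) (dpair x' y).
Proof.
move: x y; apply: diagramW => t w s st wt; apply: diagramW => t' w' s' st' wt'.
move=> /(ndiagram_expansion _ st wt)[k kt ->].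
rewrite !dpairE ?nleaves_graft ?st ?nclone_valid //.
apply/ndiagram_expansion; rewrite /= ?st ?st' //; first exact: valid_pair.
exists k; first by lia.
rewrite nperm_cat nclone_cat nperm_shift_lt // nclone_shift_lt //.
by rewrite (nperm_lt wt) // kt.
Qed.

Lemma dpair_expandr x y y' : expansion y y' -> expansion (dpair x y) (dpair x y').
Proof.
move: x y; apply: diagramW => t w s st wt; apply: diagramW => t' w' s' st' wt'.
move=> /(ndiagram_expansion _ st' wt')[k kt ->].
rewrite !dpairE ?nleaves_graft ?st' ?nclone_valid //.
apply/ndiagram_expansion; rewrite /= ?st ?st' //; first exact: valid_pair.
exists (nleaves t + k); first by lia.
rewrite nperm_cat nclone_cat nperm_shift nclone_shift.
rewrite (nperm_valid_ge wt) ?leq_addr // (nclone_valid_ge wt) ?leq_addr //.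
by rewrite !ltnNge !leq_addr /= !addKn.
Qed.

Lemma dpair_eq x x' y y' : diagram_eq x x' -> diagram_eq y y' ->
  diagram_eq (dpair x y) (dpair x' y').
Proof.
move=> xx' yy'; apply: (Relation_Operators.rst_trans _ _ _ (dpair x' y)).
  elim: xx' => {x x'} [x x' xx'|x|x x' _|x x' x'' _ + _].
  - exact/Relation_Operators.rst_step/dpair_expandl.
  - exact: Relation_Operators.rst_refl.
  - exact: Relation_Operators.rst_sym.
  - exact: Relation_Operators.rst_trans.
elim: yy' => {y y'} [y y' yy'|y|y y' _|y y' y'' _ + _].
- exact/Relation_Operators.rst_step/dpair_expandr.
- exact: Relation_Operators.rst_refl.
- exact: Relation_Operators.rst_sym.
- exact: Relation_Operators.rst_trans.
Qed.

(** The embedding of the square of the group as the stabilizer of the two halves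
    of the tree, without braiding between the halves. *)
Definition vpair (g h : Vbr) : Vbr := Vbr_class (dpair (repr g) (repr h)).

Lemma vpairE t w s t' w' s' : nleaves s = nleaves t -> nleaves s' = nleaves t' ->
    valid (nleaves t) w -> valid (nleaves t') w' ->
  vpair (vbr t w s) (vbr t' w' s') =
  vbr (Caret t t') (w ++ shift (nleaves t) w') (Caret s s').
Proof.
move=> st st' wt wt'; rewrite /vbr -dpairE //; apply/Vbr_classP/dpair_eq.
- exact/Vbr_classP/Vbr_class_repr.
- exact/Vbr_classP/Vbr_class_repr.
Qed.

(** Letters of [w] and of [shift n w'] involve disjoint, non-adjacent strands. *)
Lemma ev_shift_comm N n w w' : valid n w ->
  commute (ev N w) (ev N (shift n w')).
Proof.
elim: w => [|[e i] w IH] /=; first by move=> _; apply: commute_sym; apply: commute1.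
case/andP=> /= wn /IH{}IH; apply: commute_sym; apply: commuteM; last exact: commute_sym.
apply: commute_sym => {IH}; elim: w' => [|[e' j] w' IH'] /=; first exact: commute1.
by apply: commuteM => //; apply: sgen_far; lia.
Qed.

Lemma vbr_pairP g h : exists t w s w' u, [/\ nleaves s = nleaves t,
  nleaves u = nleaves t, valid (nleaves t) w, valid (nleaves t) w' &
  g = vbr t w s /\ h = vbr s w' u].
Proof.
move: g h; apply: Vbr_pairW => n T S U b c.
exists (val T), (nword (repr b)), (val S), (nword (repr c)), (val U).
rewrite !nleaves_tree; split=> //; try exact: nword_valid.
by rewrite /vbr -!Diagram_nword !braid_of_repr.
Qed.

(** The two factors involve different strands, so the braid of [h] can be moved
    past the braid of [g']. *)
Lemma vpairM g g' h h' : vpair (g * g') (h * h') = vpair g h * vpair g' h'.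
Proof.
have [t [w [s [w' [u [st ut wt wt' [-> ->]]]]]]] := vbr_pairP g g'.
have [t1 [w1 [s1 [w1' [u1 [st1 ut1 wt1 wt1' [-> ->]]]]]]] := vbr_pairP h h'.
rewrite !vbrM // !vpairE ?ut ?ut1 ?st ?st1 //; try by rewrite /valid all_cat; apply/andP.
rewrite vbrM /= ?st ?st1 ?ut ?ut1 //; apply: vbr_ev.
rewrite /shift map_cat !ev_cat !mulgA; congr (_ * _); rewrite -!mulgA; congr (_ * _).
exact: ev_shift_comm.
Qed.

Lemma vbr1 : vbr Leaf [::] Leaf = 1.
Proof. exact: vbr_nil. Qed.

Lemma vpair1 : vpair 1 1 = 1.
Proof. by rewrite -{1 2}vbr1 vpairE // vbr_nil. Qed.

Lemma vpair_comm g h : commute (vpair g 1) (vpair 1 h).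
Proof. by rewrite /commute -!vpairM !mulg1 !mul1g. Qed.

(** * Copies of the group in cones *)

(** The address is read from the root, with [true] for a right turn. *)
Fixpoint cone (a : seq bool) (h : Vbr) : Vbr :=
  if a is x :: a' then
    if x then vpair 1 (cone a' h) else vpair (cone a' h) 1
  else h.

Lemma coneM a g h : cone a (g * h) = cone a g * cone a h.
Proof. by elim: a => //= -[] a ->; rewrite -vpairM mulg1. Qed.

Lemma cone1 a : cone a 1 = 1.
Proof. by elim: a => //= -[] a ->; rewrite vpair1. Qed.

Lemma coneV a h : cone a h^-1 = (cone a h)^-1.
Proof. by apply: (mulIg (cone a h)); rewrite -coneM !mulVg cone1. Qed.

Lemma cone_cat a b h : cone (a ++ b) h = cone a (cone b h).
Proof. by elim: a => //= -[] a ->. Qed.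

Definition disjoint_cones (a b : seq bool) := ~~ prefix a b && ~~ prefix b a.

Lemma cone_comm a b g h : disjoint_cones a b -> commute (cone a g) (cone b h).
Proof.
elim: a b => [|x a IH] [|y b]; rewrite /disjoint_cones ?prefix0s //=.
case: x; case: y => //= ab.
- by rewrite /commute -!vpairM (IH b ab).
- exact/commute_sym/vpair_comm.
- exact: vpair_comm.
- by rewrite /commute -!vpairM (IH b ab).
Qed.

Fixpoint addr (t : bintree) (k : nat) : seq bool :=
  if t is Caret l r then
    if k < nleaves l then false :: addr l k else true :: addr r (k - nleaves l)
  else [::].

Lemma addr_inj t k k' : k < nleaves t -> k' < nleaves t -> addr t k = addr t k' -> k = k'.
Proof.
elim: t k k' => /= [|l IHl r IHr] k k'; first lia.
move=> kn kn'; case: ifP => kl; case: ifP => kl' // -[]; first exact: IHl.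
by move/IHr; lia.
Qed.

Lemma addr_graft t k : k < nleaves t ->
  addr (graft t k) k = rcons (addr t k) false /\
  addr (graft t k) k.+1 = rcons (addr t k) true.
Proof.
elim: t k => [|l IHl r IHr] k /=; first by case: k.
move=> kn; case: ifP => kl /=; rewrite ?nleaves_graft.
  have [-> ->] := IHl _ kl; rewrite !ltnS kl.
  by rewrite (ltnW kl).
rewrite kl; have -> : (k.+1 < nleaves l) = false by lia.
have -> : k.+1 - nleaves l = (k - nleaves l).+1 by lia.
by have [|-> ->] := IHr (k - nleaves l); first lia.
Qed.

(** The leaves of a binary tree form a maximal antichain, so no tree has its
    leaves strictly among those of another. *)
Lemma addr_sub_eq s t :
  (forall k, k < nleaves s -> exists2 k', k' < nleaves t & addr s k = addr t k') -> s = t.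
Proof.
elim: s t => [|l IHl r IHr] [|l' r'] // st.
- by have [//|k _] := st 0; rewrite /=; case: ifP.
- have [|k _] := st 0; first exact: nleaves_gt0.
  by rewrite /=; case: ifP.
congr Caret; [apply: IHl | apply: IHr] => k kn.
- have [|k' kn'] := st k; first by rewrite /=; lia.
  by rewrite /= kn; case: ifP => // kl [kE]; exists k'.
- have [|k' kn'] := st (nleaves l + k); first by rewrite /= ltn_add2l.
  rewrite /= ltnNge leq_addr addKn /=; case: ifP => // kl [kE].
  by exists (k' - nleaves l') => //; move: kn'; rewrite /=; lia.
Qed.

(** * Rotations of carets *)
Definition rotation : Vbr :=
  vbr (Caret Leaf (Caret Leaf Leaf)) [::] (Caret (Caret Leaf Leaf) Leaf).

(** Every tree with a caret has one whose children are both leaves; pruning it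
    gives an induction along expansions ([graft_ind]). *)
Lemma graft_last t : t <> Leaf -> exists t' k, k < nleaves t' /\ t = graft t' k.
Proof.
elim: t => // -[|l1 l2] IHl [|r1 r2] IHr _.
- by exists Leaf, 0.
- have [//|r' [k [kn ->]]] := IHr; exists (Caret Leaf r'), k.+1.
  by rewrite /= subn1.
all: have [//|l' [k [kn ->]]] := IHl.
  by exists (Caret l' Leaf), k => /=; rewrite kn; split=> //; lia.
by exists (Caret l' (Caret r1 r2)), k => /=; rewrite kn; split=> //; lia.
Qed.

Lemma graft_ind (P : bintree -> Prop) : P Leaf ->
  (forall t k, k < nleaves t -> P t -> P (graft t k)) -> forall t, P t.
Proof.
move=> P0 PS t; have [n] := ubnP (nleaves t); elim: n t => // n IH t.
case: t => // l r tn; have [//|t' [k [kn tE]]] := @graft_last (Caret l r).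
rewrite tE; apply: PS => //; apply: IH.
by move: (congr1 nleaves tE); rewrite nleaves_graft; move: tn; lia.
Qed.

Lemma vbr_expand_nil t s k : nleaves s = nleaves t -> k < nleaves t ->
  vbr t [::] s = vbr (graft t k) [::] (graft s k).
Proof. by move=> st kt; rewrite (vbr_expand st _ kt). Qed.

(** A trivial braid stays trivial under expansion, so the trees hung at the
    three leaves can be grown one caret at a time. *)
Lemma rotationE t1 t2 t3 :
  rotation = vbr (Caret t1 (Caret t2 t3)) [::] (Caret (Caret t1 t2) t3).
Proof.
elim/graft_ind: t3 => [|t3 k kn ->]; last first.
  rewrite (@vbr_expand_nil _ _ (nleaves t1 + nleaves t2 + k)) /=; try lia.
  rewrite [_ + k < nleaves t1 + _]ltnNge leq_addr addKn.
  have -> : (nleaves t1 + nleaves t2 + k < nleaves t1) = false by lia.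
  have -> : (nleaves t1 + nleaves t2 + k - nleaves t1) = nleaves t2 + k by lia.
  by rewrite [nleaves t2 + k < _]ltnNge leq_addr addKn.
elim/graft_ind: t2 => [|t2 k kn ->]; last first.
  rewrite (@vbr_expand_nil _ _ (nleaves t1 + k)) /=; try lia.
  by rewrite ltn_add2l kn [_ + k < nleaves t1]ltnNge leq_addr addKn kn.
elim/graft_ind: t1 => [//|t1 k kn ->].
rewrite (@vbr_expand_nil _ _ k) /=; try lia.
by rewrite kn (leq_trans kn) // leq_addr.
Qed.

Lemma rotation_conj g1 g2 g3 :
  rotation * vpair (vpair g1 g2) g3 = vpair g1 (vpair g2 g3) * rotation.
Proof.
have [t1 [w1 [s1 [st1 wt1 ->]]]] := vbrP g1.
have [t2 [w2 [s2 [st2 wt2 ->]]]] := vbrP g2.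
have [t3 [w3 [s3 [st3 wt3 ->]]]] := vbrP g3.
rewrite !vpairE /= ?st1 ?st2 ?st3 //; try exact: valid_pair.
rewrite {1}(rotationE t1 t2 t3) (rotationE s1 s2 s3) !vbrM /=; try lia.
congr vbr; rewrite cats0 /shift map_cat -catA -map_comp; congr (_ ++ (_ ++ _)).
by apply: eq_map => l /=; rewrite addnA.
Qed.

(** The rotation at the leaf [k] of [t], written with a common tree [t] so that it
    can be composed with a diagram that has [t] at its top or bottom. *)
Definition leaf_rotation t k : Vbr :=
  vbr (graft (graft t k) k.+1) [::] (graft (graft t k) k).

Lemma leaf_rotationE t k : k < nleaves t ->
  leaf_rotation t k = cone (addr t k) rotation.
Proof.
elim: t k => [|l IHl r IHr] k /=; first by case: k.
move=> kn; case: ifP => kl /=.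
  rewrite -IHl // -(vbr_nil r) vpairE // ?nleaves_graft //.
  by rewrite /leaf_rotation /= kl /= nleaves_graft !ltnS kl (ltnW kl).
rewrite -IHr; last lia.
rewrite -(vbr_nil l) vpairE // ?nleaves_graft // /leaf_rotation /= kl /= kl.
have -> : (k.+1 < nleaves l) = false by lia.
by have -> : k.+1 - nleaves l = (k - nleaves l).+1 by lia.
Qed.

(** Splits on the innermost conditions first, so that every hypothesis produced
    is a plain comparison of naturals. *)
Ltac nat_ifs := repeat (rewrite /=; match goal with
  | |- context [if ?b then _ else _] =>
      lazymatch b with
      | context [if _ then _ else _] => fail
      | _ => case: (boolP b) => ?; try (exfalso; lia)
      end
  end).

Lemma nperm_nclone_self w k :
  nperm (nclone k w) k = nperm w k /\ nperm (nclone k w) k.+1 = (nperm w k).+1.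
Proof.
elim: w => //= -[e i] w [IH1 IH2]; rewrite !nperm_cat IH1 IH2.
move: (nperm w k) => p; rewrite /nclone_letter /nclone_gen /cross /=.
by nat_ifs; rewrite /= /cross; split; nat_ifs; lia.
Qed.

(** After one doubling, the two parallel strands cross everything together;
    doubling either one gives three parallel strands, spelled by the same word. *)
Lemma nclone_parallel w k : nclone k.+1 (nclone k w) = nclone k (nclone k w).
Proof.
elim: w => //= -[e i] w IH; rewrite !nclone_cat IH; congr cat.
have [-> ->] := nperm_nclone_self w k; move: (nperm w k) => p {IH}.
rewrite /nclone_letter /nclone_gen /=.
by nat_ifs; rewrite /= /cross /nclone_letter /nclone_gen /=; nat_ifs.
Qed.

(** A rotation slides along a strand: expand the diagram at the strand and then at
    either half of it.  The braid is the same both times, and only the trees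
    differ, exactly by the rotations. *)
Lemma leaf_rotation_slide t w s k : nleaves s = nleaves t -> valid (nleaves t) w ->
    k < nleaves t ->
  leaf_rotation t (nperm w k) * vbr t w s = vbr t w s * leaf_rotation s k.
Proof.
move=> st wt kn; have pn := nperm_lt wt kn.
have [p0 p1] := nperm_nclone_self w k.
have wt' := nclone_valid k wt.
have gE : vbr t w s = vbr (graft t (nperm w k)) (nclone k w) (graft s k).
  exact: vbr_expand.
have E0 : vbr t w s =
    vbr (graft (graft t (nperm w k)) (nperm w k)) (nclone k (nclone k w)) (graft (graft s k) k).
  by rewrite gE (@vbr_expand _ _ _ k) ?p0 // ?nleaves_graft ?st // ltnW.
have E1 : vbr t w s =
    vbr (graft (graft t (nperm w k)) (nperm w k).+1) (nclone k (nclone k w)) (graft (graft s k) k.+1).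
  by rewrite gE (@vbr_expand _ _ _ k.+1) ?p1 // ?nclone_parallel ?nleaves_graft ?st.
rewrite {1}E0 E1 /leaf_rotation !vbrM ?cats0 // ?nleaves_graft ?st //.
Qed.

(** * Crossings *)
Definition crossing t i : Vbr := vbr t [:: (false, i)] t.

Definition conjugate (x y : Vbr) := exists g, y = x ^ g.

Lemma conjugate_refl x : conjugate x x.
Proof. by exists 1; rewrite conjg1. Qed.

Lemma conjugate_trans x y z : conjugate x y -> conjugate y z -> conjugate x z.
Proof. by move=> [g ->] [h ->]; exists (g * h); rewrite conjgM. Qed.

Lemma conjugate_sym x y : conjugate x y -> conjugate y x.
Proof. by move=> [g ->]; exists g^-1; rewrite conjgK. Qed.

Lemma conjugate_tree t s w : nleaves s = nleaves t -> conjugate (vbr t w t) (vbr s w s).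
Proof.
move=> st; exists (vbr t [::] s); apply: (mulgI (vbr t [::] s)).
by rewrite -conjgC !vbrM ?cats0 ?st.
Qed.

(** From the braid relation: with c = sigma_(i+1) sigma_i one has
    c^-1 sigma_i c = sigma_(i+1). *)
Lemma crossing_shift t i : i.+2 < nleaves t -> conjugate (crossing t i) (crossing t i.+1).
Proof.
move=> it; exists (vbr t [:: (false, i.+1); (false, i)] t).
apply: (mulgI (vbr t [:: (false, i.+1); (false, i)] t)).
rewrite -conjgC !vbrM //; apply: vbr_ev; rewrite /= !mulg1 /sgen /= !mulgA.
by rewrite gen_adj //; lia.
Qed.

Lemma crossing_first t i : i.+1 < nleaves t -> conjugate (crossing t 0) (crossing t i).
Proof.
elim: i => [|i IH] it; first exact: conjugate_refl.
by apply: conjugate_trans (crossing_shift it); apply: IH; lia.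
Qed.

Definition comb3 := Caret Leaf (Caret Leaf Leaf).

(** For a fixed number of leaves the tree is changed by conjugating with a
    braid-free diagram.  The number of leaves is changed by expanding at leaf 2,
    which the crossing of strands 0 and 1 does not notice; this is where the
    third leaf is used. *)
Lemma crossings_conjugate t i : 2 < nleaves t -> i.+1 < nleaves t ->
  conjugate (crossing comb3 0) (crossing t i).
Proof.
move=> t3 /crossing_first; apply: conjugate_trans; elim/graft_ind: t t3 => // t k kt IH.
rewrite nleaves_graft ltnS leq_eqVlt => /orP[/eqP t2|t3].
  by apply: conjugate_tree; rewrite nleaves_graft -t2.
apply: conjugate_trans (IH t3) _.
have -> : crossing t 0 = crossing (graft t 2) 0.
  by rewrite /crossing (@vbr_expand _ _ _ 2) //= andbT; lia.
by apply: conjugate_tree; rewrite !nleaves_graft.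
Qed.

(** * Normal subgroups that contain the crossings *)
Section NormalSubgroup.
Variables (K : set Vbr) (Kn : normal_subgroup K).

Lemma normal1 : K 1. Proof. by case: Kn. Qed.
Lemma normalM x y : K x -> K y -> K (x * y). Proof. by case: Kn => _ + _ _; apply. Qed.
Lemma normalV x : K x -> K x^-1. Proof. by case: Kn => _ _ + _; apply. Qed.
Lemma normalJ x g : K x -> K (x ^ g). Proof. by case: Kn => _ _ _; apply. Qed.
Lemma normalMr x y : K y -> K (x * y) -> K x.
Proof. by move=> /normalV Ky Kxy; rewrite -(mulgK y x); apply: normalM. Qed.
Lemma normalMl x y : K x -> K (x * y) -> K y.
Proof. by move=> /normalV Kx Kxy; rewrite -(mulKg x y); apply: normalM. Qed.

Lemma normal_conjugate x y : conjugate x y -> K x -> K y.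
Proof. by move=> [g ->]; apply: normalJ. Qed.

Lemma normal_words t w : (forall i, i.+1 < nleaves t -> K (crossing t i)) ->
  valid (nleaves t) w -> K (vbr t w t).
Proof.
move=> Kt; elim: w => [|[e i] w IH] /=; first by rewrite vbr_nil => _; apply: normal1.
case/andP=> /= it /IH Kw; have -> : (e, i) :: w = [:: (e, i)] ++ w by [].
rewrite -(@vbrM _ _ t) //; apply: normalM Kw; case: e; last exact: Kt.
apply: (normalMr (Kt i it)); rewrite vbrM // (@vbr_ev _ _ [::]).
  by rewrite vbr_nil; apply: normal1.
by rewrite /= mulg1 (sgen_inv _ true).
Qed.

Section Crossings.
Hypothesis Kcrossing : forall t i, 2 < nleaves t -> i.+1 < nleaves t -> K (crossing t i).

(** With two leaves, the crossing becomes a product of four crossings on four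
    leaves when both strands are doubled. *)
Lemma normal_braids t w : valid (nleaves t) w -> K (vbr t w t).
Proof.
apply: normal_words => i it; have [t3|t2] := ltnP 2 (nleaves t); first exact: Kcrossing.
have [-> {it t2}t2] : i = 0 /\ nleaves t = 2 by lia.
apply: (@normal_conjugate (crossing (Caret Leaf Leaf) 0)).
  by apply: conjugate_tree; rewrite t2.
rewrite /crossing (@vbr_expand _ _ _ 0) //= (@vbr_expand _ _ _ 2) //=.
by apply: normal_words => // j; apply: Kcrossing.
Qed.

(** Expanding (t, sigma_k, t) at leaf [k] puts the top caret at [k.+1], because the
    strand that ends at position [k] starts at [k.+1].  Cancelling the braid leaves
    the braid-free diagram. *)
Lemma normal_graft_next t k : k.+1 < nleaves t ->
  K (vbr (graft t k.+1) [::] (graft t k)).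
Proof.
move=> kt; have vk : valid (nleaves t) [:: (false, k)] by rewrite /= kt.
have := normal_braids vk; rewrite (@vbr_expand _ _ _ k) //; last lia.
have := nclone_valid k vk; rewrite /= /cross eqxx; set w := (_ ++ _) => wv.
rewrite -[w]cats0 -(@vbrM _ _ (graft t k.+1)) ?nleaves_graft //.
by move=> Kw; apply: (normalMl _ Kw); apply: normal_braids; rewrite nleaves_graft.
Qed.

Lemma normal_graft0 t k : k < nleaves t -> K (vbr (graft t k) [::] (graft t 0)).
Proof.
elim: k => [|k IH] kt; first by rewrite vbr_nil; apply: normal1.
rewrite -[[::]]cats0 -(@vbrM _ _ (graft t k)) ?nleaves_graft //.
by apply: normalM; [apply: normal_graft_next | apply: IH; lia].
Qed.

Definition left_comb n := iter n.-1 (graft^~ 0) Leaf.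

Lemma nleaves_left_comb n : 0 < n -> nleaves (left_comb n) = n.
Proof. by case: n => // n _; rewrite /left_comb /=; elim: n => //= n IH; rewrite nleaves_graft IH. Qed.

(** Build [t] caret by caret; each new caret is moved to leaf 0, where it extends
    the comb. *)
Lemma normal_left_comb t : K (vbr t [::] (left_comb (nleaves t))).
Proof.
elim/graft_ind: t => [|t k kt IH]; first by rewrite vbr_nil; apply: normal1.
have t0 := nleaves_gt0 t; have cE := nleaves_left_comb t0.
rewrite nleaves_graft -[[::]]cats0 -(@vbrM _ _ (graft t 0)) ?nleaves_graft ?nleaves_left_comb //.
apply: normalM; first exact: normal_graft0.
by rewrite (vbr_expand_nil cE t0) in IH; rewrite -(prednK t0) in IH *.
Qed.

Lemma normal_crossings_full g : K g.
Proof.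
have [t [w [s [st wt ->]]]] := vbrP g.
have cE := nleaves_left_comb (nleaves_gt0 t).
rewrite -[w]cats0 -(@vbrM _ _ t) //; apply: normalM; first exact: normal_braids.
rewrite -[[::]]cats0 -(@vbrM _ _ (left_comb (nleaves t))) //; apply: normalM.
  exact: normal_left_comb.
apply: (normalMr (normal_left_comb s)); rewrite vbrM ?st // vbr_nil.
exact: normal1.
Qed.
End Crossings.

(** * Perfectness *)
Section Commutators.
Hypothesis Kcomm : forall g h, K [~ g, h].

Let a := crossing comb3 0.

Lemma crossing_coset t i : 2 < nleaves t -> i.+1 < nleaves t -> K (crossing t i * a^-1).
Proof.
move=> t3 it; have [g ->] := crossings_conjugate t3 it.
have := normalJ a^-1 (Kcomm a g).
by rewrite commgEl [_ ^ a^-1]conjgE invgK -mulgA mulKVg.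
Qed.

(** Modulo [K] a positive braid counts only through its number of crossings. *)
Lemma positive_coset t (s : seq nat) : 2 < nleaves t ->
    all (fun i => i.+1 < nleaves t) s ->
  K (vbr t [seq (false, i) | i <- s] t * a ^- size s).
Proof.
move=> t3; elim: s => [|i s IH] /=.
  by rewrite vbr_nil expg0 mul1g invg1 => _; apply: normal1.
case/andP=> it /IH Ks; have -> : (false, i) :: [seq (false, i) | i <- s] =
  [:: (false, i)] ++ [seq (false, i) | i <- s] by [].
rewrite -(@vbrM _ _ t) // expgS invMg.
set x := vbr t _ t; set y := vbr t _ t.
have -> : x * y * (a ^- size s * a^-1) = (y * a ^- size s) ^ x^-1 * (x * a^-1).
  by rewrite conjgE invgK -!mulgA mulKg.
by apply: normalM; [exact: normalJ | exact: (crossing_coset t3 it)].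
Qed.

Lemma normal_comb3_crossing : K a.
Proof.
(* the two strands that cross are doubled: leaf 0, then the other strand, whose
   bottom position has become 2 *)
have a4 : K (a * a ^- 4).
  have {1}-> : a = vbr (graft (graft comb3 1) 0) [seq (false, i) | i <- [:: 1; 0; 2; 1]%N]
                 (graft (graft comb3 0) 2).
    by rewrite /a /crossing (@vbr_expand _ _ _ 0) //= (@vbr_expand _ _ _ 2).
  exact: (@positive_coset _ [:: 1; 0; 2; 1]%N).
(* the same with tripled strands *)
have a9 : K (a * a ^- 9).
  have {1}-> : a = vbr (graft (graft (graft (graft comb3 1) 2) 0) 1)
      [seq (false, i) | i <- [:: 2; 1; 0; 3; 2; 1; 4; 3; 2]%N]
      (graft (graft (graft (graft comb3 0) 1) 3) 4).
    rewrite /a /crossing (@vbr_expand _ _ _ 0) //= (@vbr_expand _ _ _ 1) //=.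
    by rewrite (@vbr_expand _ _ _ 3) //= (@vbr_expand _ _ _ 4) //=.
  exact: (@positive_coset _ [:: 2; 1; 0; 3; 2; 1; 4; 3; 2]%N).
have {}a4 : K (a ^+ 3).
  by move/normalV: a4; rewrite invMg invgK (expgSr a 3) mulgK.
have {}a9 : K (a ^+ 8).
  by move/normalV: a9; rewrite invMg invgK (expgSr a 8) mulgK.
apply: (normalMl a9); rewrite -expgSr.
have -> : a ^+ 9 = a ^+ 3 * a ^+ 3 * a ^+ 3 by rewrite -!expgnDr.
by apply: normalM => //; apply: normalM.
Qed.

Lemma normal_commutators_full g : K g.
Proof.
apply: normal_crossings_full => t i t3 it.
exact: normal_conjugate (crossings_conjugate t3 it) normal_comb3_crossing.
Qed.
End Commutators.
End NormalSubgroup.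

(** * Elements outside the pure part *)

(** Only comparable addresses are at stake: if [v] extends [u] by a turn [b], the
    child of [u] on the side opposite to [b] is disjoint from the cone of [v]. *)
Lemma disjoint_rcons u v : u <> v -> exists x, disjoint_cones (rcons u x) (rcons v x).
Proof.
elim: u v => [|a u IH] [|b v] //= uv.
- by exists (~~ b); rewrite /disjoint_cones /=; case: b {uv}.
- by exists (~~ a); rewrite /disjoint_cones /=; case: a {uv}.
rewrite /disjoint_cones /=; have [ab|_] := eqVneq a b; last by exists true.
by apply: IH => uv'; apply: uv; rewrite ab uv'.
Qed.

(** If every leaf stays in place, the leaves of [s] are leaves of [t], so the trees
    agree, and then the permutation of the braid is trivial. *)
Lemma not_Pbr_moves t w s : nleaves s = nleaves t -> valid (nleaves t) w ->
    ~ Pbr (vbr t w s) ->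
  exists2 k, k < nleaves t & addr s k <> addr t (nperm w k).
Proof.
move=> st wt gP; apply: contrapT => fixed; apply: gP.
have {}fixed k : k < nleaves t -> addr s k = addr t (nperm w k).
  by move=> kt; apply: contrapT => ?; apply: fixed; exists k.
have tE : s = t.
  apply: addr_sub_eq => k; rewrite st => kt.
  by exists (nperm w k); [exact: nperm_lt | exact: fixed].
subst s; have [T [S [w0 [Tt St wE gE]]]] := ndiagramP st wt.
have ST : S = T by apply: val_inj; rewrite Tt.
rewrite /vbr gE ST.
exists (nleaves t), T, (braid_of w0); split=> //.
rewrite /pure braid_perm_of; apply/perm.permP => p; apply: val_inj.
rewrite val_word_perm perm1 -wE; apply/esym/(@addr_inj t).
- exact: ltn_ord.
- exact: (nperm_lt wt (ltn_ord p)).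
- exact: (fixed _ (ltn_ord p)).
Qed.

Lemma not_Pbr_disjoint g : ~ Pbr g -> exists t w s k,
  [/\ nleaves s = nleaves t, valid (nleaves t) w, k < nleaves t, g = vbr t w s &
      disjoint_cones (addr s k) (addr t (nperm w k))].
Proof.
have [t [w [s [st wt ->]]]] := vbrP g.
move=> /(not_Pbr_moves st wt)[k kt /disjoint_rcons[x ux]].
have [p0 p1] := nperm_nclone_self w k.
have ks : k < nleaves s by rewrite st.
have [s0 s1] := addr_graft ks; have [t0 t1] := addr_graft (nperm_lt wt kt).
exists (graft t (nperm w k)), (nclone k w), (graft s k), (if x then k.+1 else k).
rewrite !nleaves_graft st; split=> //.
- exact: nclone_valid.
- by case: x {ux}; rewrite ltnS // ltnW.
- exact: vbr_expand.
- by case: x ux => ux; rewrite ?p0 ?p1 ?s0 ?s1 ?t0 ?t1.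
Qed.

Lemma rotation_cone h :
  rotation * cone [:: false; true] h = cone [:: true; false] h * rotation.
Proof. exact: rotation_conj. Qed.

(** Two commutator steps.  The quotient [y] of two conjugate rotations is in [N].
    Conjugation by [y] takes the copy [al] of the group to the copy [be], since the
    rotation at [v] does and the one at [u] commutes with [al].  So [be h * (al h)^-1]
    is in [N]; as [al] commutes with [be], its commutator with [be h'] is, up to
    conjugation by [al h], that of [be h] with [be h']. *)
Lemma normal_contains_cone N g : normal_subgroup N -> N g -> ~ Pbr g ->
  exists2 c, c <> [::] & forall h h', N (cone c [~ h, h']).
Proof.
move=> Nn Ng /not_Pbr_disjoint[t [w [s [k [st wt kt gE uv]]]]].
have := leaf_rotation_slide st wt kt.
rewrite -gE !leaf_rotationE ?st ?nperm_lt //.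
move: (addr s k) (addr t _) uv => u v uv slide.
pose y := cone v rotation * (cone u rotation)^-1.
have Ny : N y.
  have -> : y = g * g^-1 ^ (cone u rotation)^-1.
    by rewrite conjgE invgK !mulgA -slide mulgK.
  by apply: (normalM Nn) => //; apply/(normalJ Nn)/(normalV Nn).
exists (v ++ [:: true; false]); first by case: v {uv slide y Ny}.
pose al h := cone v (cone [:: false; true] h).
pose be h := cone v (cone [:: true; false] h).
have y_al h : y * al h = be h * y.
  have uc : commute (cone u rotation)^-1 (al h).
    by apply/commute_sym/commuteV/commute_sym/cone_comm.
  by rewrite -mulgA uc !mulgA -!coneM rotation_cone.
have al_be h h' : commute (al h) (be h').
  by rewrite /commute -!coneM [X in cone v X]vpair_comm.
move=> h h'; rewrite cone_cat.
have Nz : N (be h * (al h)^-1).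
  have -> : be h * (al h)^-1 = y * y^-1 ^ (al h)^-1.
    by rewrite conjgE invgK !mulgA y_al mulgK.
  by apply: (normalM Nn) => //; apply/(normalJ Nn)/(normalV Nn).
have -> : cone v (cone [:: true; false] [~ h, h']) = [~ be h, be h'].
  by rewrite /commg /conjg !coneM !coneV.
have comm_al : commute (al h)^-1 (be h').
  by apply/commute_sym/commuteV/commute_sym/al_be.
have -> : [~ be h, be h'] = [~ be h * (al h)^-1, be h'] ^ al h.
  have -> : [~ be h * (al h)^-1, be h'] = al h * [~ be h, be h'] * (al h)^-1.
    by rewrite !commgEl invMg invgK conjMg (conjg_fixP (introT commgP comm_al)) !mulgA.
  by rewrite conjgE -!mulgA mulVg mulg1 mulKg.
by apply: (normalJ Nn); apply: (normalM Nn); [apply: (normalV Nn) | apply: (normalJ Nn)].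
Qed.

Lemma cone_normal N c : normal_subgroup N -> normal_subgroup [set h | N (cone c h)].
Proof.
move=> Nn; split=> /= [|x y|x|x g].
- by rewrite cone1; apply: (normal1 Nn).
- by rewrite coneM; apply: (normalM Nn).
- by rewrite coneV; apply: (normalV Nn).
- by rewrite /conjg !coneM coneV; apply: (normalJ Nn (cone c g)).
Qed.

(** A proper cone sees the crossing of two strands next to at least one more leaf,
    so the two-leaf crossing becomes one on at least three leaves. *)
Lemma cone_crossing c : c <> [::] -> exists t i,
  [/\ 2 < nleaves t, i.+1 < nleaves t & cone c (crossing (Caret Leaf Leaf) 0) = crossing t i].
Proof.
have step (x : bool) t i : 1 < nleaves t -> i.+1 < nleaves t -> exists t' i',
    [/\ 2 < nleaves t', i'.+1 < nleaves t' &
        cone [:: x] (crossing t i) = crossing t' i'].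
  move=> t2 it; have vi : valid (nleaves t) [:: (false, i)] by rewrite /= it.
  case: x => /=; rewrite -vbr1 /crossing vpairE //.
    by exists (Caret Leaf t), i.+1; split=> //=; lia.
  by exists (Caret t Leaf), i; split=> //=; lia.
elim: c => // x c IH _; case: c IH => [_|y c IH]; first exact: step.
have [//|t [i [t3 it cE]]] := IH; have [||t' [i' [t3' it' sE]]] := step x t i => //.
  exact: ltnW.
by exists t', i'; rewrite -sE -cE.
Qed.

Theorem corollary2p8 (N : set Vbr) (N_normal : normal_subgroup N)
  (N_proper : N <> [set: Vbr]) : N `<=` Pbr.
Proof.
move=> g Ng; apply: contrapT => gP; apply: N_proper.
have [c c0 Nc] := normal_contains_cone N_normal Ng gP.
have Ncone := normal_commutators_full (cone_normal c N_normal) Nc.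
have [t [i [t3 it cE]]] := cone_crossing c0.
apply/seteqP; split=> // h _; apply: (normal_crossings_full N_normal) => t' i' t3' it'.
apply: (normal_conjugate N_normal _ (Ncone (crossing (Caret Leaf Leaf) 0))).
rewrite cE; apply: conjugate_trans (crossings_conjugate t3' it').
exact/conjugate_sym/crossings_conjugate.
Qed.
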